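(* Let $R$ be a left Zacharias domain, $\mathsf R$ a multivariate Ore extension of $R$ in which each $\alpha_i$ is an automorphism of $R$, and $F=\{g_1,\dots,g_u\}\subset\mathsf R^m\setminus\{0\}$ a finite set with $\mathbf M(g_i)=c_i\tau_i\mathbf e_{l_i}$. Let $\mathsf T$ be the set of all terms $\mathrm{lcm}(\tau_i:i\in H)\,\mathbf e_{l}$, where $H$ ranges over the nonempty subsets of $\{1,\dots,u\}$ on which $i\mapsto l_i$ is constant, with value $l$. For $\mathsf m=\delta\epsilon\in\mathsf T$ let $t_i(\mathsf m)=\delta/\tau_i$ and $v(\mathsf m)_i=\alpha_{t_i(\mathsf m)}(c_i)$ if $\mathbf T(g_i)\mid\mathsf m$, and $t_i(\mathsf m)=v(\mathsf m)_i=0$ otherwise; let $C(\mathsf m)\subset R^u$ be a finite generating set of the left $R$-module $\{(d_1,\dots,d_u)\in R^u:\sum_id_iv(\mathsf m)_i=0\}$ and $S(\mathsf m)=\{(d_1t_1(\mathsf m),\dots,d_ut_u(\mathsf m)):(d_i)\in C(\mathsf m)\}$; let $\mathcal S(F)=\bigcup_{\mathsf m\in\mathsf T}S(\mathsf m)$. Let $\mathcal S'(F)\subset\mathcal S(F)$ be any subset such that each $\sigma\in\mathcal S(F)\setminus\mathcal S'(F)$ can be written as a finite sum $\sigma=\sum_jd_j\omega_j\ast\sigma_j$ with $\sigma_j\in\mathcal S'(F)$, $d_j\in R$, $\omega_j\in\mathcal T$, and let $\mathcal R(F)=\{\sum_im_i\star g_i:(m_1,\dots,m_u)\in\mathcal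 S'(F)\}$. Then: (1) $\mathcal S'(F)$ is a left Gebauer–Möller set for $F$; (2) $F$ is a left Gröbner basis of the left module it generates if and only if each $h\in\mathcal R(F)$ has a left Gröbner representation in terms of $F$.
   Context: **Ore extensions.** $R$ is a (not necessarily commutative) domain with identity. A multivariate Ore extension $\mathsf R=R[Y_1;\alpha_1,\delta_1]\cdots[Y_n;\alpha_n,\delta_n]$ is an iterated Ore extension ($Y_i\star r=\alpha_i(r)Y_i+\delta_i(r)$, $\alpha_i$ an injective ring endomorphism mapping $R$ to $R$, $\delta_i$ an $\alpha_i$-derivation mapping $R$ to $R$) such that $\alpha_j\delta_i=\delta_i\alpha_j$ for $i\ne j$, $\alpha_i\alpha_j=\alpha_j\alpha_i$, $\delta_i\delta_j=\delta_j\delta_i$, and $\alpha_j(Y_i)=Y_i$, $\delta_j(Y_i)=0$ for $i<j$. Its multiplication is $\star$. It is a free left $R$-module on the set of terms $\mathcal T=\{Y_1^{a_1}\cdots Y_n^{a_n}\}$, a commutative monoid. For $\tau=Y_1^{a_1}\cdots Y_n^{a_n}$ put $\alpha_\tau=\alpha_1^{a_1}\cdots\alpha_n^{a_n}:R\to R$. The associated graded Ore extension $\mathsf S=R[Y_1;\alpha_1]\cdots[Y_n;\alpha_n]$ is the same left $R$-module with multiplication $\ast$ determined by $(a\tau)\ast(b\omega)=a\,\alpha_\tau(b)\,\tau\omega$. **Orderings.** $\mathsf R^m$ has canonical basis $\mathbf e_1,\dots,\mathbf e_m$ and terms $\mathcal T^{(m)}=\{t\mathbf e_i\}$; $\tau\mathbf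 e_i\mid\omega\mathbf e_j$ means $i=j$ and $\tau\mid\omega$. Fix a term ordering $\prec$ on $\mathcal T$ and a compatible term ordering $<$ on $\mathcal T^{(m)}$: a well-ordering with $\omega_1\prec\omega_2\Rightarrow\omega_1t<\omega_2t$ and $t_1<t_2\Rightarrow\omega t_1<\omega t_2$. $\mathbf T(f)$, $\mathrm{lc}(f)$ and $\mathbf M(f)=\mathrm{lc}(f)\mathbf T(f)$ are maximal term, leading coefficient and maximal monomial. **Gröbner notions.** $F$ is a left (weak) Gröbner basis of the left module $\mathsf M$ it generates if for every $f\in\mathsf M\setminus\{0\}$ one has $\mathbf M(f)=\sum_ia_i\lambda_i\ast\mathbf M(g_{j_i})$ with $a_i\in R\setminus\{0\}$, $\lambda_i\in\mathcal T$, $\lambda_i\mathbf T(g_{j_i})=\mathbf T(f)$. A left Gröbner representation of $f$ is $f=\sum_il_i\star g_i$ with $l_i\in\mathsf R$ and $\mathbf T(l_i)\mathbf T(g_i)\le\mathbf T(f)$ whenever $l_i\ne0$ (the zero element has the trivial representation). **Gebauer–Möller sets.** Let $e_1,\dots,e_u$ be the canonical basis of $\mathsf S^u$ and $\mathfrak s_L:\mathsf S^u\to\mathsf S^m$, $\mathfrak s_L(\sum h_ie_i)=\sum h_i\ast\mathbf M(g_i)$. An element $\sum a_i\lambda_ie_i$ ($a_i\in R,\lambda_i\in\mathcal T$) is $\mathcal T^{(m)}$-homogeneous if $\lambda_i\mathbf T(g_i)$ is the same term for all $i$ with $a_i\ne0$ (zero is allowed as an element of a generating set). A left Gebauer–Möller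 set for $F$ is a set of $\mathcal T^{(m)}$-homogeneous generators of the left $\mathsf S$-module $\ker(\mathfrak s_L)$. **Zacharias ring.** A ring $R$ with identity is a left Zacharias ring if (a) it is noetherian; (b) there is an algorithm which, given $c\in R^m$ and a finite $C=\{c_1,\dots,c_t\}\subset R^m\setminus\{0\}$, decides whether $c$ lies in the left module generated by $C$ and, if so, produces $d_i\in R$ with $c=\sum d_ic_i$; (c) there is an algorithm which, given $\{c_1,\dots,c_t\}\subset R^m\setminus\{0\}$, computes a finite set of generators of the left syzygy module $\{(d_1,\dots,d_t)\in R^t:\sum d_ic_i=0\}$. *)

(* Defs.v *)
From HB Require Import structures.
From mathcomp Require Import all_boot all_order all_algebra.
From mathcomp Require Import ssrcomplements.
From mathcomp Require Export mpoly.

Set Implicit Arguments.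
Unset Strict Implicit.
Unset Printing Implicit Defensive.

Import GRing.Theory.
Local Open Scope ring_scope.

Record ore_datum (R : nzRingType) (n : nat) := OreDatum {
  oalpha : 'I_n -> {rmorphism R -> R};
  odelta : 'I_n -> {additive R -> R};
  oalpha_inj : forall i, injective (oalpha i);
  odeltaM : forall i a b,
    odelta i (a * b) = oalpha i a * odelta i b + odelta i a * b;
  oalphaC : forall i j a, oalpha i (oalpha j a) = oalpha j (oalpha i a);
  odeltaC : forall i j a, odelta i (odelta j a) = odelta j (odelta i a);
  oalpha_deltaC : forall i j a, i != j ->
    oalpha j (odelta i a) = odelta i (oalpha j a)
}.

Section GradedDatum.
Variables (R : nzRingType) (n : nat) (D : ore_datum R n).

Let zero_delta (_ : 'I_n) : {additive R -> R} := \0.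

Fact graded_deltaM i a b :
  zero_delta i (a * b) = oalpha D i a * zero_delta i b + zero_delta i a * b.
Proof. by rewrite /= mulr0 mul0r addr0. Qed.

Fact graded_alpha_deltaC i j a : i != j ->
  oalpha D j (zero_delta i a) = zero_delta i (oalpha D j a).
Proof. by move=> _ /=; rewrite rmorph0. Qed.

Definition graded : ore_datum R n :=
  OreDatum (@oalpha_inj _ _ D) graded_deltaM (@oalphaC _ _ D)
    (fun i j a => erefl) graded_alpha_deltaC.

End GradedDatum.

Section OreMul.
Variables (R : nzRingType) (n : nat) (D : ore_datum R n).
Implicit Types (f g h : {mpoly R[n]}) (t w : 'X_{1..n}) (a b : R) (i j : 'I_n).

Definition alpha_term t a : R :=
  foldr (fun i x => iter (t i) (oalpha D i) x) a (enum 'I_n).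

(* Y_i * (sum_t a_t t) = sum_t (alpha_i(a_t) (Y_i t) + delta_i(a_t) t). *)
Definition ore_lmulY i g : {mpoly R[n]} :=
  map_mpoly (oalpha D i) g * 'X_i + map_mpoly (odelta D i) g.

Definition ore_lmulX t g : {mpoly R[n]} :=
  foldr (fun i x => iter (t i) (ore_lmulY i) x) g (enum 'I_n).

Definition ore_mul f g : {mpoly R[n]} :=
  \sum_(t <- msupp f) f@_t *: ore_lmulX t g.

Fact ore_lmulY_is_additive i : additive (ore_lmulY i).
Proof. by move=> f g; rewrite /ore_lmulY !raddfB /= mulrBl opprD addrACA. Qed.
HB.instance Definition _ i :=
  GRing.isAdditive.Build {mpoly R[n]} {mpoly R[n]} (ore_lmulY i)
    (ore_lmulY_is_additive i).

Lemma ore_lmulYD i : {morph ore_lmulY i : f g / f + g}.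
Proof. exact: raddfD. Qed.

Lemma odelta1 i : odelta D i 1 = 0.
Proof.
have := odeltaM D i 1 1; rewrite !mulr1 rmorph1 mul1r.
by move/(congr1 (fun x => x - odelta D i 1)); rewrite addrK subrr => <-.
Qed.

Lemma map_odeltaZ i a g : map_mpoly (odelta D i) (a *: g) =
  oalpha D i a *: map_mpoly (odelta D i) g + odelta D i a *: g.
Proof.
by apply/mpolyP=> m; rewrite mcoeffD !(mcoeff_map_mpoly, mcoeffZ) odeltaM.
Qed.

Lemma ore_lmulYZ i a g :
  ore_lmulY i (a *: g) = oalpha D i a *: ore_lmulY i g + odelta D i a *: g.
Proof.
by rewrite /ore_lmulY map_mpolyZ map_odeltaZ -scalerAl addrA scalerDr.
Qed.

Lemma map_odeltaX i t : map_mpoly (odelta D i) 'X_[t] = 0.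
Proof.
apply/mpolyP=> m; rewrite mcoeff_map_mpoly mcoeffX mcoeff0.
by case: (_ == _); rewrite /= ?odelta1 ?raddf0.
Qed.

Lemma ore_lmulY_X i t : ore_lmulY i 'X_[t] = 'X_[(U_(i) + t)%MM].
Proof. by rewrite /ore_lmulY map_odeltaX addr0 map_mpolyX -mpolyXD addmC. Qed.

Lemma map_odelta_mulX i t g :
  map_mpoly (odelta D i) (g * 'X_[t]) = map_mpoly (odelta D i) g * 'X_[t].
Proof.
elim/mpolyind: g => [|c m p _ _ IH]; first by rewrite raddf0 !mul0r raddf0.
rewrite mulrDl !raddfD /= mulrDl IH; congr (_ + _).
by rewrite -scalerAl -mpolyXD !map_odeltaZ !map_odeltaX !scaler0 !add0r
  -scalerAl mpolyXD.
Qed.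

Lemma ore_lmulYC i j g :
  ore_lmulY i (ore_lmulY j g) = ore_lmulY j (ore_lmulY i g).
Proof.
have [->//|nij] := eqVneq i j.
rewrite /ore_lmulY !raddfD /= !map_odelta_mulX !rmorphM /= !map_mpolyX.
rewrite !mulrDl -!mulrA -!mpolyXD.
have aa : map_mpoly (oalpha D i) (map_mpoly (oalpha D j) g) =
          map_mpoly (oalpha D j) (map_mpoly (oalpha D i) g).
  by apply/mpolyP=> m; rewrite !mcoeff_map_mpoly /= oalphaC.
have dd : map_mpoly (odelta D i) (map_mpoly (odelta D j) g) =
          map_mpoly (odelta D j) (map_mpoly (odelta D i) g).
  by apply/mpolyP=> m; rewrite !mcoeff_map_mpoly /= odeltaC.
have ad : map_mpoly (oalpha D i) (map_mpoly (odelta D j) g) =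
          map_mpoly (odelta D j) (map_mpoly (oalpha D i) g).
  by apply/mpolyP=> m; rewrite !mcoeff_map_mpoly /= oalpha_deltaC // eq_sym.
have da : map_mpoly (odelta D i) (map_mpoly (oalpha D j) g) =
          map_mpoly (oalpha D j) (map_mpoly (odelta D i) g).
  by apply/mpolyP=> m; rewrite !mcoeff_map_mpoly /= oalpha_deltaC.
rewrite aa dd ad da (addmC U_(j)%MM) -!addrA; congr (_ + _).
by rewrite !addrA; congr (_ + _); rewrite addrC.
Qed.

Lemma iter_ore_lmulYC i j k l g :
  iter k (ore_lmulY i) (iter l (ore_lmulY j) g) =
  iter l (ore_lmulY j) (iter k (ore_lmulY i) g).
Proof.
have S1 x : ore_lmulY i (iter l (ore_lmulY j) x) = iter l (ore_lmulY j) (ore_lmulY i x).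
  by elim: l => //= l <-; rewrite ore_lmulYC.
by elim: k => //= k ->.
Qed.

Lemma ore_lmulX_foldrC i k (s : seq 'I_n) t g :
  iter k (ore_lmulY i) (foldr (fun j x => iter (t j) (ore_lmulY j) x) g s) =
  foldr (fun j x => iter (t j) (ore_lmulY j) x) (iter k (ore_lmulY i) g) s.
Proof. by elim: s => //= j s <-; rewrite iter_ore_lmulYC. Qed.

Lemma ore_lmulXD t w g : ore_lmulX (t + w)%MM g = ore_lmulX t (ore_lmulX w g).
Proof.
rewrite /ore_lmulX; elim: (enum 'I_n) g => //= i s IH g.
by rewrite mnmDE iterD IH ore_lmulX_foldrC.
Qed.

Lemma ore_lmulX0 g : ore_lmulX 0%MM g = g.
Proof. by rewrite /ore_lmulX; elim: (enum _) => //= i s ->; rewrite mnm0E. Qed.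

Lemma ore_lmulXU i g : ore_lmulX U_(i)%MM g = ore_lmulY i g.
Proof.
rewrite /ore_lmulX; have := mem_enum 'I_n i; rewrite inE.
elim: (enum _) (enum_uniq 'I_n) => //= j s IH /andP[js us].
rewrite inE mnm1E; have [->|nij] := eqVneq i j => /=.
  move=> _; congr (ore_lmulY _ _).
  elim: s js {IH us} => //= k s IH; rewrite inE negb_or => /andP[jk /IH->].
  by rewrite mnm1E (negPf jk).
exact: IH.
Qed.

Fact ore_lmulX_is_additive t : additive (ore_lmulX t).
Proof.
move=> f g; rewrite /ore_lmulX; elim: (enum _) => //= i s ->.
by elim: (t i) => //= k ->; rewrite raddfB.
Qed.
HB.instance Definition _ t :=
  GRing.isAdditive.Build {mpoly R[n]} {mpoly R[n]} (ore_lmulX t)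
    (ore_lmulX_is_additive t).

Lemma ore_lmulX_X t w : ore_lmulX t 'X_[w] = 'X_[(t + w)%MM].
Proof.
have iterX i k v : iter k (ore_lmulY i) 'X_[v] = 'X_[(U_(i) *+ k + v)%MM].
  elim: k => [|k IH] /=; first by rewrite mulm0n add0m.
  by rewrite IH ore_lmulY_X mulmS addmA.
rewrite [in RHS](multinomUE_id t) -big_enum /ore_lmulX.
elim: (enum _) => [|i s IH]; first by rewrite big_nil add0m.
by rewrite big_cons /= IH iterX addmA.
Qed.

Lemma ore_mulwE k f g : (msize f <= k)%N ->
  ore_mul f g = \sum_(t : 'X_{1..n < k}) f@_t *: ore_lmulX t g.
Proof.
move=> lt_fk; rewrite /ore_mul (big_mksub 'X_{1..n < k}) ?msupp_uniq //=.
  rewrite big_rmcond //= => t /memN_msupp_eq0 ->; by rewrite scale0r.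
by move=> t /msize_mdeg_lt /leq_trans; apply.
Qed.

Lemma ore_mulDl : left_distributive ore_mul +%R.
Proof.
move=> f g h; pose k := maxn (msize (f + g)) (maxn (msize f) (msize g)).
rewrite !(@ore_mulwE k) ?leq_max ?leqnn ?orbT // -big_split /=.
by apply: eq_bigr => t _; rewrite mcoeffD scalerDl.
Qed.

Lemma ore_mulDr : right_distributive ore_mul +%R.
Proof.
move=> f g h; rewrite /ore_mul -big_split /=.
by apply: eq_bigr => t _; rewrite raddfD scalerDr.
Qed.

Lemma ore_mul0l g : ore_mul 0 g = 0.
Proof. by rewrite /ore_mul msupp0 big_nil. Qed.

Lemma ore_mulZl a f g : ore_mul (a *: f) g = a *: ore_mul f g.
Proof.
pose k := maxn (msize (a *: f)) (msize f).
rewrite !(@ore_mulwE k) ?leq_max ?leqnn ?orbT // scaler_sumr.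
by apply: eq_bigr => t _; rewrite mcoeffZ scalerA.
Qed.

Lemma ore_mulX t g : ore_mul 'X_[t] g = ore_lmulX t g.
Proof. by rewrite /ore_mul msuppX big_seq1 mcoeffX eqxx scale1r. Qed.

Lemma ore_mul1l : left_id 1 ore_mul.
Proof. by move=> g; rewrite -mpolyX0 ore_mulX ore_lmulX0. Qed.

Lemma ore_mul1r : right_id 1 ore_mul.
Proof.
move=> f; rewrite /ore_mul -[in LHS]mpolyX0 [RHS]mpolyE.
by apply: eq_bigr => t _; rewrite ore_lmulX_X addm0.
Qed.

Lemma ore_mul_lmulY i g h :
  ore_mul (ore_lmulY i g) h = ore_lmulY i (ore_mul g h).
Proof.
elim/mpolyind: g => [|a t p _ _ IH]; first by rewrite raddf0 !ore_mul0l raddf0.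
rewrite ore_lmulYD (ore_mulDl (ore_lmulY i _)) (ore_mulDl (a *: 'X_[t])) ore_lmulYD IH.
congr (_ + _).
rewrite ore_lmulYZ ore_mulDl !ore_mulZl ore_lmulYZ ore_lmulY_X !ore_mulX.
by rewrite ore_lmulXD ore_lmulXU.
Qed.

Lemma ore_mul_lmulX t g h :
  ore_mul (ore_lmulX t g) h = ore_lmulX t (ore_mul g h).
Proof.
rewrite /ore_lmulX; elim: (enum _) => //= i s <-.
by elim: (t i) => //= k <-; rewrite ore_mul_lmulY.
Qed.

Lemma ore_mulA : associative ore_mul.
Proof.
move=> f g h; apply/esym; elim/mpolyind: f => [|a t p _ _ IH].
  by rewrite !ore_mul0l.
by rewrite !ore_mulDl IH !ore_mulZl !ore_mulX ore_mul_lmulX.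
Qed.

End OreMul.

(* The multivariate Ore extension R[Y_1; alpha_1, delta_1]...[Y_n; alpha_n,
   delta_n]: its elements are the finite sums of the a Y^t, encoded as
   a *: 'X_[t], and its product is ore_mul, not the product of {mpoly R[n]}. *)
Record ore (R : nzRingType) (n : nat) (D : ore_datum R n) : Type :=
  Ore { opoly : {mpoly R[n]} }.

Section OreRing.
Variables (R : nzRingType) (n : nat) (D : ore_datum R n).
Local Notation ore := (ore D).
Local Notation Ore := (@Ore R n D).
Implicit Types (f g : ore) (a b : R) (t w : 'X_{1..n}) (i j : 'I_n).

HB.instance Definition _ := [isNew for @opoly R n D].
HB.instance Definition _ := [Choice of ore by <:].

Lemma opoly_inj : injective (@opoly R n D). Proof. exact: val_inj. Qed.

Fact ore_addA : associative (fun f g => Ore (opoly f + opoly g)).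
Proof. by move=> f g h; rewrite addrA. Qed.
Fact ore_addC : commutative (fun f g => Ore (opoly f + opoly g)).
Proof. by move=> f g; rewrite addrC. Qed.
Fact ore_add0 : left_id (Ore 0) (fun f g => Ore (opoly f + opoly g)).
Proof. by case=> f; rewrite add0r. Qed.
Fact ore_addN : left_inverse (Ore 0) (fun f => Ore (- opoly f))
  (fun f g => Ore (opoly f + opoly g)).
Proof. by move=> f; rewrite addNr. Qed.
HB.instance Definition _ :=
  GRing.isZmodule.Build ore ore_addA ore_addC ore_add0 ore_addN.

Fact opoly_is_additive : additive (@opoly R n D). Proof. by []. Qed.
HB.instance Definition _ :=
  GRing.isAdditive.Build ore {mpoly R[n]} (@opoly R n D) opoly_is_additive.

Fact ore_scaleA a b f :
  Ore (a *: opoly (Ore (b *: opoly f))) = Ore ((a * b) *: opoly f).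
Proof. by rewrite scalerA. Qed.
Fact ore_scale1 : left_id 1 (fun a f => Ore (a *: opoly f)).
Proof. by case=> f; rewrite scale1r. Qed.
Fact ore_scaleDr : right_distributive (fun a f => Ore (a *: opoly f)) +%R.
Proof. by move=> a f g; apply: opoly_inj; rewrite /= scalerDr. Qed.
Fact ore_scaleDl f : {morph (fun a => Ore (a *: opoly f)) : a b / a + b}.
Proof. by move=> a b; apply: opoly_inj; rewrite /= scalerDl. Qed.
HB.instance Definition _ :=
  GRing.Zmodule_isLmodule.Build R ore ore_scaleA ore_scale1 ore_scaleDr
    ore_scaleDl.

Definition ore_ring_mul f g : ore := Ore (ore_mul D (opoly f) (opoly g)).

Fact ore_ring_mulA : associative ore_ring_mul.
Proof. by move=> f g h; rewrite /ore_ring_mul ore_mulA. Qed.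
Fact ore_ring_mul1l : left_id (Ore 1) ore_ring_mul.
Proof. by case=> f; rewrite /ore_ring_mul ore_mul1l. Qed.
Fact ore_ring_mul1r : right_id (Ore 1) ore_ring_mul.
Proof. by case=> f; rewrite /ore_ring_mul ore_mul1r. Qed.
Fact ore_ring_mulDl : left_distributive ore_ring_mul +%R.
Proof. by move=> f g h; apply: opoly_inj; rewrite /= ore_mulDl. Qed.
Fact ore_ring_mulDr : right_distributive ore_ring_mul +%R.
Proof. by move=> f g h; apply: opoly_inj; rewrite /= ore_mulDr. Qed.
Fact ore_ring_oner_neq0 : Ore 1 != 0.
Proof. exact: (oner_neq0 {mpoly R[n]}). Qed.
HB.instance Definition _ :=
  GRing.Zmodule_isNzRing.Build ore ore_ring_mulA ore_ring_mul1l ore_ring_mul1r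
    ore_ring_mulDl ore_ring_mulDr ore_ring_oner_neq0.

Fact ore_scaleAl a f g : a *: (f * g) = a *: f * g.
Proof. by apply: opoly_inj; rewrite /= ore_mulZl. Qed.
HB.instance Definition _ := GRing.Lmodule_isLalgebra.Build R ore ore_scaleAl.

Definition omon a t : ore := Ore (a *: 'X_[t]).

Definition oreY i : ore := omon 1 U_(i).

Lemma opolyZ a f : opoly (a *: f) = a *: opoly f. Proof. by []. Qed.
Lemma opolyM f g : opoly (f * g) = ore_mul D (opoly f) (opoly g).
Proof. by []. Qed.

Lemma opoly_sum (I : Type) (r : seq I) (P : pred I) (F : I -> ore) :
  opoly (\sum_(x <- r | P x) F x) = \sum_(x <- r | P x) opoly (F x).
Proof. exact: raddf_sum. Qed.

Lemma oreYM i f : opoly (oreY i * f) = ore_lmulY D i (opoly f).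
Proof. by rewrite opolyM /= scale1r ore_mulX ore_lmulXU. Qed.

Lemma ore_sum f : f = \sum_(t <- msupp (opoly f)) omon (opoly f)@_t t.
Proof. by apply: opoly_inj; rewrite raddf_sum /= -mpolyE. Qed.

Lemma omon_scale a t : omon a t = a *: omon 1 t.
Proof. by apply: opoly_inj; rewrite opolyZ /= scale1r. Qed.

Lemma omon1M t w : omon 1 t * omon 1 w = omon 1 (t + w).
Proof. by apply: opoly_inj; rewrite /= !scale1r ore_mulX ore_lmulX_X. Qed.

Lemma omonE a t : omon a t = a *: \prod_(i < n) oreY i ^+ t i.
Proof.
rewrite omon_scale; congr (_ *: _); rewrite [in LHS](multinomUE_id t).
apply: (big_ind2 (fun w y => omon 1 w = y)).
- by apply: opoly_inj; rewrite /= scale1r mpolyX0.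
- by move=> w1 y1 w2 y2 <- <-; rewrite omon1M.
move=> i _; elim: (t i) => [|k IH].
  by apply: opoly_inj; rewrite /= scale1r mpolyX0.
by rewrite mulmS exprS -IH omon1M.
Qed.

Lemma oreYC i j : oreY i * oreY j = oreY j * oreY i.
Proof. by rewrite !omon1M addmC. Qed.

Lemma oreY_scalar i a :
  oreY i * a%:A = oalpha D i a *: oreY i + (odelta D i a)%:A.
Proof.
apply: opoly_inj; rewrite oreYM raddfD /= ore_lmulYZ; congr (_ *: _ + _).
by rewrite -mpolyX0 ore_lmulY_X addm0 scale1r.
Qed.

End OreRing.

Lemma graded_omonM (R : nzRingType) (n : nat) (D : ore_datum R n)
    (a b : R) (t w : 'X_{1..n}) :
  omon (graded D) a t * omon (graded D) b w =
  omon (graded D) (a * alpha_term D t b) (t + w).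
Proof.
apply: opoly_inj; rewrite /= ore_mulZl ore_mulX -scalerA; congr (_ *: _).
rewrite -(ore_lmulX_X (graded D)) /ore_lmulX /alpha_term; elim: (enum _) b => //= i s IH b.
rewrite IH; elim: (t i) => //= k ->.
by rewrite ore_lmulYZ /= scale0r addr0.
Qed.

(* ore D is an iterated Ore extension: stage k+1 is free over stage k on the
   powers of Y_k, which acts on it through ore_alpha k and ore_delta k. *)
Section Tower.
Variables (R : nzRingType) (n : nat) (D : ore_datum R n).
Implicit Types (f g : ore D) (i j k : 'I_n).

(* Stage k is generated over R by the Y_j with j < k. *)
Definition ore_stage (k : nat) f : Prop :=
  forall t, t \in msupp (opoly f) -> forall j, (k <= j)%N -> t j = 0%N.

Definition ore_alpha k f : ore D := Ore D (map_mpoly (oalpha D k) (opoly f)).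
Definition ore_delta k f : ore D := Ore D (map_mpoly (odelta D k) (opoly f)).

Lemma ore_stage0 f : ore_stage 0 f <-> exists a, f = a%:A.
Proof.
split=> [f0|[a ->] t].
  exists (opoly f)@_0; apply: opoly_inj; apply/mpolyP=> t.
  rewrite opolyZ mcoeffZ mcoeff1; have [->|nt0] := eqVneq t 0%MM.
    by rewrite mulr1.
  rewrite mulr0; apply: memN_msupp_eq0; apply: contraNN nt0 => /f0 t0.
  by apply/eqP/mnmP=> j; rewrite mnm0E t0.
rewrite opolyZ => /msuppZ_le; rewrite msupp1 inE => /eqP-> j _.
by rewrite mnm0E.
Qed.

Lemma ore_stagen f : ore_stage n f.
Proof. by move=> t _ j; rewrite leqNgt ltn_ord. Qed.

Lemma ore_alpha_scalar k a : ore_alpha k a%:A = (oalpha D k a)%:A.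
Proof. by apply: opoly_inj; rewrite /= map_mpolyZ rmorph1. Qed.

Lemma ore_delta_scalar k a : ore_delta k a%:A = (odelta D k a)%:A.
Proof.
by apply: opoly_inj; rewrite /= map_odeltaZ -mpolyX0 map_odeltaX scaler0 add0r.
Qed.

Lemma ore_alphaY k i : ore_alpha k (oreY D i) = oreY D i.
Proof. by apply: opoly_inj; rewrite /= !scale1r map_mpolyX. Qed.

Lemma ore_deltaY k i : ore_delta k (oreY D i) = 0.
Proof. by apply: opoly_inj; rewrite /= scale1r map_odeltaX. Qed.

Lemma ore_alpha_inj k : injective (ore_alpha k).
Proof.
move=> f g /(congr1 (@opoly _ _ _)) /= E; apply: opoly_inj; apply/mpolyP=> t.
by apply: (@oalpha_inj _ _ D k); rewrite -!mcoeff_map_mpoly E.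
Qed.

Lemma ore_stage_alpha (r : nat) k f : ore_stage r f -> ore_stage r (ore_alpha k f).
Proof.
move=> fr t; rewrite /= mcoeff_msupp mcoeff_map_mpoly => nz; apply: fr.
by rewrite mcoeff_msupp; apply: contra_neq nz => /= ->; rewrite raddf0.
Qed.

Lemma ore_stage_delta (r : nat) k f : ore_stage r f -> ore_stage r (ore_delta k f).
Proof.
move=> fr t; rewrite /= mcoeff_msupp mcoeff_map_mpoly => nz; apply: fr.
by rewrite mcoeff_msupp; apply: contra_neq nz => /= ->; rewrite raddf0.
Qed.

Lemma oreY_comm k f : oreY D k * f = ore_alpha k f * oreY D k + ore_delta k f.
Proof.
apply: opoly_inj; rewrite oreYM raddfD /= /ore_lmulY; congr (_ + _).
rewrite scale1r /ore_mul [in LHS](mpolyE (map_mpoly _ _)) mulr_suml.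
by apply: eq_bigr => t _; rewrite ore_lmulX_X -scalerAl mpolyXD.
Qed.

Lemma map_ore_lmulY k i (p : {mpoly R[n]}) : i != k ->
  map_mpoly (oalpha D k) (ore_lmulY D i p) =
    ore_lmulY D i (map_mpoly (oalpha D k) p) /\
  map_mpoly (odelta D k) (ore_lmulY D i p) =
    ore_lmulY D i (map_mpoly (odelta D k) p).
Proof.
move=> nik; rewrite /ore_lmulY !raddfD /= map_odelta_mulX rmorphM /= map_mpolyX.
split; congr (_ * _ + _); apply/mpolyP=> t; rewrite !mcoeff_map_mpoly /=.
- by rewrite oalphaC.
- by rewrite oalpha_deltaC.
- by rewrite oalpha_deltaC // eq_sym.
- by rewrite odeltaC.
Qed.

Lemma map_ore_lmulX k (t : 'X_{1..n}) (p : {mpoly R[n]}) : t k = 0%N ->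
  map_mpoly (oalpha D k) (ore_lmulX D t p) =
    ore_lmulX D t (map_mpoly (oalpha D k) p) /\
  map_mpoly (odelta D k) (ore_lmulX D t p) =
    ore_lmulX D t (map_mpoly (odelta D k) p).
Proof.
move=> tk; rewrite /ore_lmulX; elim: (enum _) => //= i s [<- <-].
have [->|nik] := eqVneq i k; first by rewrite tk.
by elim: (t i) => //= r [<- <-]; apply: map_ore_lmulY.
Qed.

Lemma ore_stage_coef k f (t : 'X_{1..n}) :
  ore_stage k f -> (opoly f)@_t = 0 \/ t k = 0%N.
Proof.
move=> fk; have [/fk/(_ k)|/memN_msupp_eq0] := boolP (t \in msupp (opoly f)).
  by move=> tk; right; apply: tk.
by left.
Qed.

Lemma ore_alphaM k f g : ore_stage k f ->
  ore_alpha k (f * g) = ore_alpha k f * ore_alpha k g.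
Proof.
move=> fk; apply: opoly_inj; rewrite /=.
pose N := maxn (msize (opoly f)) (msize (map_mpoly (oalpha D k) (opoly f))).
rewrite !(@ore_mulwE _ _ _ N) ?leq_max ?leqnn ?orbT // raddf_sum.
apply: eq_bigr => t _; rewrite /= map_mpolyZ mcoeff_map_mpoly /=.
have [->|tk] := ore_stage_coef t fk; first by rewrite rmorph0 !scale0r.
by rewrite (proj1 (map_ore_lmulX _ tk)).
Qed.

Lemma ore_deltaM k f g : ore_stage k f ->
  ore_delta k (f * g) = ore_alpha k f * ore_delta k g + ore_delta k f * g.
Proof.
move=> fk; apply: opoly_inj; rewrite /=.
pose N := maxn (msize (opoly f)) (maxn
  (msize (map_mpoly (oalpha D k) (opoly f)))
  (msize (map_mpoly (odelta D k) (opoly f)))).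
rewrite !(@ore_mulwE _ _ _ N) ?leq_max ?leqnn ?orbT // raddf_sum -big_split.
apply: eq_bigr => t _; rewrite /= map_odeltaZ !mcoeff_map_mpoly /=.
have [->|tk] := ore_stage_coef t fk.
  by rewrite rmorph0 raddf0 !scale0r.
by rewrite (proj2 (map_ore_lmulX _ tk)).
Qed.

Lemma ore_stage_add (r : nat) f g :
  ore_stage r f -> ore_stage r g -> ore_stage r (f + g).
Proof.
by move=> fr gr t /msuppD_le; rewrite mem_cat => /orP[/fr|/gr].
Qed.

Lemma ore_stage_scale (r : nat) a f : ore_stage r f -> ore_stage r (a *: f).
Proof. by move=> fr t /msuppZ_le/fr. Qed.

Lemma ore_stage_mul (r : nat) f g :
  ore_stage r f -> ore_stage r g -> ore_stage r (f * g).
Proof.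
move=> fr gr; rewrite [f]ore_sum mulr_suml big_seq.
apply: (big_ind (ore_stage r)) => [t||t tf]; first by rewrite msupp0.
  exact: ore_stage_add.
rewrite omon_scale -scalerAl; apply: ore_stage_scale.
have YP i h : (i < r)%N -> ore_stage r h -> ore_stage r (oreY D i * h).
  move=> ir hr; rewrite oreY_comm; apply: ore_stage_add; last first.
    exact: ore_stage_delta.
  have {}hr := ore_stage_alpha (k := i) hr; move=> w.
  rewrite opolyM /= scale1r /ore_mul => /msupp_sum_le/flattenP[s /mapP[v]].
  rewrite mem_filter /= => vh -> /msuppZ_le; rewrite ore_lmulX_X msuppX inE.
  move=> /eqP-> j rj; rewrite mnmDE (hr v vh j rj) mnm1E.
  by case: eqP => // ij; move: ir; rewrite ij ltnNge rj.
have := omonE D 1 t; rewrite scale1r => ->.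
elim: (index_enum _) => [|i s IH]; first by rewrite big_nil mul1r.
rewrite big_cons -mulrA.
have [ri|ir] := leqP r i; first by rewrite (fr _ tf _ ri) expr0 mul1r.
elim: (t i) => [|e IHe]; first by rewrite expr0 mul1r.
by rewrite exprS -mulrA; apply: YP.
Qed.

Lemma opolyMY k f (e : nat) :
  opoly (f * oreY D k ^+ e) = opoly f * 'X_[U_(k) *+ e].
Proof.
have -> : oreY D k ^+ e = omon D 1 (U_(k) *+ e).
  elim: e => [|e IH]; last by rewrite exprS IH omon1M mulmS.
  by rewrite expr0 mulm0n; apply: opoly_inj; rewrite /= mpolyX0 scale1r.
rewrite opolyM /= scale1r /ore_mul [in RHS](mpolyE (opoly f)) mulr_suml.
by apply: eq_bigr => t _; rewrite ore_lmulX_X -scalerAl mpolyXD.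
Qed.

Lemma ore_stageS k f : ore_stage k.+1 f <->
  exists (N : nat) (p : 'I_N -> ore D),
    (forall e, ore_stage k (p e)) /\ f = \sum_(e < N) p e * oreY D k ^+ e.
Proof.
split=> [fk|[N [p [pk ->]]]]; last first.
  apply: (big_ind (ore_stage k.+1)) => [t||e _]; first by rewrite msupp0.
    exact: ore_stage_add.
  move=> t; rewrite opolyMY {1}[opoly (p e)]mpolyE mulr_suml.
  move=> /msupp_sum_le/flattenP[s /mapP[v]]; rewrite mem_filter /= => vp ->.
  rewrite -scalerAl => /msuppZ_le; rewrite -mpolyXD msuppX inE => /eqP-> j kj.
  rewrite mnmDE (pk e v vp j (ltnW kj)) mulmnE mnm1E.
  by case: eqP => // kj'; move: kj; rewrite kj' ltnn.
exists (msize (opoly f)).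
exists (fun e => \sum_(t <- msupp (opoly f) | t k == e :> nat)
          omon D (opoly f)@_t (t - U_(k) *+ e)); split=> [e|].
  rewrite big_seq_cond; apply: (big_ind (ore_stage k)) => [t||t /andP[tf /eqP te] w].
  - by rewrite msupp0.
  - exact: ore_stage_add.
  move=> /msuppZ_le; rewrite msuppX inE => /eqP-> j kj.
  rewrite mnmBE mulmnE mnm1E.
  have [kj'|njk] := eqVneq k j; first by rewrite -te -kj' mul1n subnn.
  by rewrite subn0; apply: (fk t tf j); rewrite ltn_neqAle val_eqE njk.
have le_tk (t : 'X_{1..n}) : (U_(k) *+ t k <= t)%MM.
  apply/mnm_lepP=> j; rewrite mulmnE mnm1E.
  by have [->|] := eqVneq k j; rewrite ?mul1n.
apply: opoly_inj; rewrite opoly_sum.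
transitivity (\sum_(e < msize (opoly f)) \sum_(t <- msupp (opoly f) | t k == e)
                (opoly f)@_t *: 'X_[t]); last first.
  apply: eq_bigr => e _; rewrite opolyMY opoly_sum mulr_suml.
  apply: eq_bigr => t /eqP te /=.
  by rewrite -scalerAl -mpolyXD -te submK.
rewrite {1}[opoly f]mpolyE (exchange_big_dep xpredT) //= !big_seq.
apply: eq_bigr => t tf.
have ltk : (t k < msize (opoly f))%N.
  apply: leq_ltn_trans (msize_mdeg_lt tf).
  by rewrite mdegE (bigD1 k) //= leq_addr.
by rewrite (big_pred1 (Ordinal ltk)) // => e; rewrite /= eq_sym.
Qed.

Lemma ore_stageS_uniq k (N : nat) (p : 'I_N -> ore D) :
    (forall e, ore_stage k (p e)) ->
  \sum_(e < N) p e * oreY D k ^+ e = 0 -> forall e, p e = 0.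
Proof.
move=> pk p0 e; apply: opoly_inj; apply/mpolyP=> t; rewrite mcoeff0.
have [//|tk] := ore_stage_coef t (pk e).
move/(congr1 (fun f => (opoly f)@_(t + U_(k) *+ e))): p0.
rewrite mcoeff0 opoly_sum (eq_bigr _ (fun d _ => opolyMY k (p d) d)).
rewrite raddf_sum (bigD1 e) //=.
rewrite addmC mcoeffMX big1 ?addr0 // => d nde.
rewrite [opoly (p d)]mpolyE mulr_suml raddf_sum big_seq big1 //= => v vp.
rewrite -scalerAl mcoeffZ -mpolyXD mcoeffX.
case: eqP => [/(congr1 (fun w : 'X_{1..n} => w k))|]; last by rewrite mulr0.
rewrite !mnmDE !mulmnE mnm1E eqxx !mul1n tk (pk d v vp k) // addn0 add0n.
by move=> de; move: nde; rewrite -val_eqE /= de eqxx.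
Qed.

End Tower.

Section Span.
Variables (S : nzRingType) (V : lmodType S).

Definition lspan (P : V -> Prop) (v : V) : Prop :=
  exists s : seq (S * V),
    (forall p, p \in s -> P p.2) /\ v = \sum_(p <- s) p.1 *: p.2.

Definition left_submodule (I : V -> Prop) : Prop :=
  I 0 /\ forall (a : S) (x y : V), I x -> I y -> I (a *: x + y).

End Span.

Definition left_noetherian (R : nzRingType) : Prop :=
  forall I : R^o -> Prop, left_submodule I ->
    exists s : seq R^o, forall x, I x <-> lspan (fun y => y \in s) x.

(* An algorithm is given as a function, c_1, ..., c_t in R^m being the rows of
   a matrix C. As R is not commutative, note that d *m C has k-th entry
   sum_i d_i * C_ik: this is the left combination sum_i d_i c_i. *)
Record left_zacharias (R : nzRingType) : Type := LeftZacharias {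
  zach_noetherian : left_noetherian R;
  zach_solve : forall m t : nat, 'M[R]_(t, m) -> 'rV[R]_m -> option 'rV[R]_t;
  zach_solveP : forall (m t : nat) (C : 'M[R]_(t, m)) (c : 'rV[R]_m),
    (forall i, row i C != 0) ->
    if zach_solve C c is Some d then c = d *m C
    else forall d : 'rV[R]_t, c <> d *m C;
  zach_syz : forall m t : nat, 'M[R]_(t, m) -> seq 'rV[R]_t;
  zach_syzP : forall (m t : nat) (C : 'M[R]_(t, m)),
    (forall i, row i C != 0) ->
    forall d : 'rV[R]_t, lspan (fun x => x \in zach_syz C) d <-> d *m C = 0
}.

Definition mterm (n m : nat) : Type := ('X_{1..n} * 'I_m)%type.
HB.instance Definition _ n m := Choice.on (mterm n m).

Definition tmul n m (w : 'X_{1..n}) (t : mterm n m) : mterm n m :=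
  ((w + t.1)%MM, t.2).

Definition tdvd n m (s t : mterm n m) : bool :=
  (s.2 == t.2) && (s.1 <= t.1)%MM.

Definition strict_well_order (T : eqType) (lt : rel T) : Prop :=
  [/\ irreflexive lt, transitive lt,
      forall x y, x != y -> lt x y || lt y x &
      well_founded (fun x y => lt x y)].

Definition term_order n (tlt : rel 'X_{1..n}) : Prop :=
  strict_well_order tlt /\
  forall w t1 t2, tlt t1 t2 -> tlt (w + t1)%MM (w + t2)%MM.

Definition compatible_term_order n m
    (tlt : rel 'X_{1..n}) (mlt : rel (mterm n m)) : Prop :=
  [/\ strict_well_order mlt,
      forall w1 w2 t, tlt w1 w2 -> mlt (tmul w1 t) (tmul w2 t) &
      forall w t1 t2, mlt t1 t2 -> mlt (tmul w t1) (tmul w t2)].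

Section Maximum.
Variables (T : eqType) (lt : rel T).

(* Maximum of a finite list; None, for the empty list, is below every term. *)
Definition omaximum (s : seq T) : option T :=
  foldr (fun x o => if o is Some y then Some (if lt x y then y else x)
                    else Some x) None s.

Definition ole (x y : option T) : bool :=
  match x, y with
  | Some a, Some b => (a == b) || lt a b
  | None, _ => true
  | Some _, None => false
  end.

End Maximum.

Section Groebner.
Variables (R : nzRingType) (n : nat) (D : ore_datum R n) (m : nat).
Variables (tlt : rel 'X_{1..n}) (mlt : rel (mterm n m)).
Local Notation OR := (ore D).
Local Notation OS := (ore (graded D)).

Definition vsupp (f : 'rV[OR]_m) : seq (mterm n m) :=
  [seq (t, k) | k <- enum 'I_m, t <- msupp (opoly (f 0 k))].

(* maxT 0 = None. *)
Definition maxT (f : 'rV[OR]_m) : option (mterm n m) := omaximum mlt (vsupp f).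

Definition omaxT (l : OR) : option 'X_{1..n} := omaximum tlt (msupp (opoly l)).

Definition vmon (a : R) (t : mterm n m) : 'rV[OS]_m :=
  omon (graded D) a t.1 *: delta_mx 0 t.2.

(* M(f) lives in the free module over the graded extension, where * acts. *)
Definition maxM (f : 'rV[OR]_m) : 'rV[OS]_m :=
  if maxT f is Some t then vmon (opoly (f 0 t.2))@_(t.1) t else 0.

Section Family.
Variables (u : nat) (g : 'I_u -> 'rV[OR]_m).

Definition left_groebner_basis : Prop :=
  forall f : 'rV[OR]_m, lspan (fun x => exists i, x = g i) f -> f != 0 ->
  exists s : seq (R * 'X_{1..n} * 'I_u),
    (forall p, p \in s ->
       p.1.1 != 0 /\ omap (tmul p.1.2) (maxT (g p.2)) = maxT f) /\
    maxM f = \sum_(p <- s) omon (graded D) p.1.1 p.1.2 *: maxM (g p.2).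

Definition has_left_groebner_rep (f : 'rV[OR]_m) : Prop :=
  exists l : 'I_u -> OR,
    f = \sum_i l i *: g i /\
    forall i, l i != 0 ->
      ole mlt (obind (fun w => omap (tmul w) (maxT (g i))) (omaxT (l i)))
        (maxT f).

Definition sL (h : 'rV[OS]_u) : 'rV[OS]_m := \sum_i h 0 i *: maxM (g i).

Definition homogeneous (h : 'rV[OS]_u) : Prop :=
  exists (a : 'I_u -> R) (lam : 'I_u -> 'X_{1..n}),
    h = \row_i omon (graded D) (a i) (lam i) /\
    forall i j, a i != 0 -> a j != 0 ->
      omap (tmul (lam i)) (maxT (g i)) = omap (tmul (lam j)) (maxT (g j)).

Definition gebauer_moeller (P : 'rV[OS]_u -> Prop) : Prop :=
  (forall h, P h -> homogeneous h) /\ forall h, sL h = 0 <-> lspan P h.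

End Family.

Section Syzygies.
Variables (u : nat) (c : 'I_u -> R) (tau : 'I_u -> 'X_{1..n}) (l : 'I_u -> 'I_m).

Definition lcm_terms (t : mterm n m) : Prop :=
  exists H : {set 'I_u},
    [/\ H != set0, forall i, i \in H -> l i = t.2 &
        t.1 = \big[@mlcm n/0%MM]_(i in H) tau i].

Definition vcoef (t : mterm n m) (i : 'I_u) : R :=
  if tdvd (tau i, l i) t then alpha_term D (t.1 - tau i)%MM (c i) else 0.

Definition syz_gens (t : mterm n m) (C : seq 'rV[R]_u) : Prop :=
  forall d : 'rV[R]_u,
    lspan (fun x => x \in C) d <-> \sum_i d 0 i * vcoef t i = 0.

Definition lift_syz (t : mterm n m) (d : 'rV[R]_u) : 'rV[OS]_u :=
  \row_i (if tdvd (tau i, l i) t then omon (graded D) (d 0 i) (t.1 - tau i)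
          else 0).

Definition syz_set (C : mterm n m -> seq 'rV[R]_u) (s : 'rV[OS]_u) : Prop :=
  exists t, lcm_terms t /\ exists2 d, d \in C t & s = lift_syz t d.

Definition reduced_syz_set (P Q : 'rV[OS]_u -> Prop) : Prop :=
  (forall s, Q s -> P s) /\
  forall s, P s -> ~ Q s ->
    exists r : seq (R * 'X_{1..n} * 'rV[OS]_u),
      (forall p, p \in r -> Q p.2) /\
      s = \sum_(p <- r) omon (graded D) p.1.1 p.1.2 *: p.2.

End Syzygies.

(* The Ore extension and its graded version have the same left R-module. *)
Definition ungrade (f : OS) : OR := Ore D (opoly f).

Definition syz_values u (g : 'I_u -> 'rV[OR]_m) (Q : 'rV[OS]_u -> Prop)
    (h : 'rV[OR]_m) : Prop :=
  exists2 s, Q s & h = \sum_i ungrade (s 0 i) *: g i.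

End Groebner.

(* Main.v *)
Require Import Defs.
From HB Require Import structures.
From mathcomp Require Import all_boot all_order all_algebra.
From Stdlib Require Import Classical_Prop.

(* A family h is a syzygy of the M(g_i) iff each of its homogeneous components
   is, and the component of degree w is given by a syzygy over R of the vector
   v(w).  If x is the lcm of the T(g_i) dividing w and w = v x, then
   v(w)_i = alpha_v(v(x)_i); as alpha_v is bijective, the syzygies at w are v
   times those at x, and x lies in the set of lcm terms.  This gives (1).

   For (2), call f representable below w if f = sum_i h_i g_i with all terms
   t T(g_i), t in h_i, smaller than w.  Graded and ungraded products differ only
   in lower terms, so Groebner representations of the values of the generators
   make the value of every syzygy of degree w representable below w.  Hence
   the top component of a representation of f exceeding T(f) can be pushed down,
   until its degree is T(f), when it exhibits M(f).  Conversely, for a Groebner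
   basis, cancelling M(f) repeatedly builds a representation of f. *)

Set Implicit Arguments.
Unset Strict Implicit.
Unset Printing Implicit Defensive.

Import GRing.Theory.
Local Open Scope ring_scope.

(** * Closure properties of left spans, and induction on them *)

Section LeftSpan.
Variables (S : nzRingType) (V : lmodType S) (P : V -> Prop).

Lemma lspan0 : lspan P 0.
Proof. by exists [::]; rewrite big_nil. Qed.

Lemma lspanD x y : lspan P x -> lspan P y -> lspan P (x + y).
Proof.
move=> [s [sP ->]] [t [tP ->]]; exists (s ++ t); rewrite big_cat; split=> // p.
by rewrite mem_cat => /orP[/sP|/tP].
Qed.

Lemma lspanZ a x : lspan P x -> lspan P (a *: x).
Proof.
move=> [s [sP ->]]; exists [seq (a * p.1, p.2) | p <- s].
split=> [_ /mapP[p /sP Pp ->] //|].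
by rewrite big_map scaler_sumr; apply: eq_bigr => p _; rewrite scalerA.
Qed.

Lemma lspan_mem x : P x -> lspan P x.
Proof.
by move=> Px; exists [:: (1, x)]; rewrite big_seq1 scale1r; split=> // p /[!inE] /eqP->.
Qed.

Lemma lspan_ind (Q : V -> Prop) : Q 0 -> (forall x y, Q x -> Q y -> Q (x + y)) ->
  (forall a x, P x -> Q (a *: x)) -> forall x, lspan P x -> Q x.
Proof.
move=> Q0 QD QZ _ [s [sP ->]]; rewrite big_seq.
by apply: big_ind => // p /sP; apply: QZ.
Qed.

End LeftSpan.

(** * Exponents: induction, lcm and divisibility *)

Section Multinomials.
Variable n : nat.
Implicit Types t w : 'X_{1..n}.

Lemma multinom_ind (P : 'X_{1..n} -> Prop) : P 0%MM ->
  (forall i t, P t -> P (U_(i) + t)%MM) -> forall t, P t.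
Proof.
move=> P0 PS t; have [k le_tk] := ubnP (mdeg t); elim: k => // k IH in t le_tk *.
have [i ti|t0] := pickP (fun i => t i != 0%N); last first.
  suff -> : t = 0%MM by [].
  by apply/mnmP=> i; have /negbFE/eqP-> := t0 i; rewrite mnm0E.
have leU : (U_(i) <= t)%MM.
  by apply/mnm_lepP => j; rewrite mnm1E; case: eqP => // <-; rewrite lt0n.
rewrite -(submK leU) addmC; apply/PS/IH.
by move: le_tk; rewrite -{1}(submK leU) mdegD mdeg1 addn1 ltnS.
Qed.

Lemma lem_big_mlcm (I : finType) (H : {set I}) (F : I -> 'X_{1..n}) w :
  (\big[@mlcm n/0%MM]_(i in H) F i <= w)%MM = [forall i in H, (F i <= w)%MM].
Proof.
rewrite -big_andE; apply: (big_morph (fun v => (v <= w)%MM)) => [x y|].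
  by rewrite lem_mlcm.
by apply/mnm_lepP=> i; rewrite mnm0E.
Qed.

Lemma mcoeffMXE (R : nzRingType) (p : {mpoly R[n]}) t w :
  (p * 'X_[t])@_w = if (t <= w)%MM then p@_(w - t) else 0.
Proof.
have [le_tw|nle] := boolP (t <= w)%MM.
  by rewrite -{1}(submK le_tw) addmC mcoeffMX.
rewrite [p]mpolyE mulr_suml raddf_sum big1 //= => v _.
rewrite -scalerAl mcoeffZ -mpolyXD mcoeffX; case: eqP => [e|]; last by rewrite mulr0.
by rewrite -e lem_addl in nle.
Qed.

End Multinomials.

(** * Maxima of finite lists of terms *)

Section Maxima.
Variables (T : eqType) (lt : rel T).

Lemma omaximum_None s : omaximum lt s = None -> s = [::].
Proof. by case: s => //= x s; case: (omaximum _ _). Qed.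

Hypothesis lt_order : strict_well_order lt.

Lemma omaximum_Some s x : omaximum lt s = Some x ->
  x \in s /\ forall y, y \in s -> (y == x) || lt y x.
Proof.
have [_ trans tot _] := lt_order.
elim: s x => //= y s; case E: (omaximum lt s) => [z|] IH x [<-]; last first.
  rewrite (omaximum_None E); split; first exact: mem_head.
  by move=> w; rewrite inE => ->.
have [zs zmax] := IH z erefl.
case: ifPn => [ltyz|nlt]; rewrite inE ?zs ?eqxx ?orbT; split=> // w; rewrite inE.
  by case/predU1P => [->|/zmax //]; rewrite ltyz orbT.
case/predU1P => [->|/zmax]; first by rewrite eqxx.
have [<-|nyz] := eqVneq y z; first by [].
have /(_ nyz) := tot y z; rewrite (negPf nlt) /= => ltzy.
by case/predU1P => [->|/trans/(_ ltzy)->]; rewrite ?ltzy orbT.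
Qed.

End Maxima.

(** If t came before 1, its powers would form an infinite descending chain. *)
Lemma term_order_gt0 n (tlt : rel 'X_{1..n}) : term_order tlt ->
  forall t, t != 0%MM -> tlt 0%MM t.
Proof.
move=> [[irr trans tot wf] homo] t tn0.
have /orP[//|ltt0] : tlt 0%MM t || tlt t 0%MM by apply: tot; rewrite eq_sym.
have: forall v, ~ exists k, v = (t *+ k)%MM.
  apply: (well_founded_ind wf) => v IH [k ev].
  apply: (IH (t *+ k.+1)%MM); last by exists k.+1.
  rewrite ev mulmS addmC -{2}[(t *+ k)%MM]addm0; exact: homo.
by case/(_ 0%MM); exists 0%N; rewrite mulm0n.
Qed.

(** * Coefficients and supports of row vectors *)

Section RowCoefficients.
Variables (R : nzRingType) (n : nat) (D : ore_datum R n) (m : nat).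
Implicit Types (f h : 'rV[ore D]_m) (k : 'I_m) (t : 'X_{1..n}).

Definition rcoef k t f : R := (opoly (f 0 k))@_t.

Lemma rcoefP f h : (forall k t, rcoef k t f = rcoef k t h) -> f = h.
Proof. by move=> e; apply/rowP=> k; apply/opoly_inj/mpolyP/e. Qed.

Fact rcoef_is_additive k t : additive (rcoef k t).
Proof. by move=> f h; rewrite /rcoef !mxE; apply: mcoeffB. Qed.
HB.instance Definition _ k t :=
  GRing.isAdditive.Build 'rV[ore D]_m R (rcoef k t) (rcoef_is_additive k t).

Definition supp_in (A : 'X_{1..n} -> 'I_m -> Prop) f :=
  forall k t, rcoef k t f != 0 -> A t k.

Lemma supp_in0 A : supp_in A 0.
Proof. by move=> k t; rewrite raddf0 eqxx. Qed.

Lemma supp_inD A f h : supp_in A f -> supp_in A h -> supp_in A (f + h).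
Proof.
move=> fA hA k t; rewrite raddfD /=.
by have [->|/fA] := eqVneq (rcoef k t f) 0; rewrite ?add0r; first exact: hA.
Qed.

Lemma rcoef_omonZ k t a w f :
  rcoef k t (omon D a w *: f) = a * (ore_lmulX D w (opoly (f 0 k)))@_t.
Proof. by rewrite /rcoef mxE opolyM /= ore_mulZl ore_mulX mcoeffZ. Qed.

End RowCoefficients.

(** * The endomorphisms alpha_t and products in the graded extension *)

Section AlphaTerm.
Variables (R : nzRingType) (n : nat) (D : ore_datum R n).
Implicit Types (t w : 'X_{1..n}) (a b : R).

Local Notation gmon := (omon (graded D)).

Lemma mcoeff_omon (E : ore_datum R n) a t w :
  (opoly (omon E a t))@_w = if t == w then a else 0.
Proof. by rewrite /= mcoeffZ mcoeffX; case: eqP; rewrite ?mulr1 ?mulr0. Qed.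

Lemma omon_inj (E : ore_datum R n) t : injective (omon E ^~ t).
Proof.
by move=> a b /(congr1 (fun p => (opoly p)@_t)); rewrite !mcoeff_omon eqxx.
Qed.

Lemma omon0 (E : ore_datum R n) t : omon E 0 t = 0.
Proof. by apply: opoly_inj; rewrite /= scale0r. Qed.

Lemma omonD (E : ore_datum R n) a b t : omon E (a + b) t = omon E a t + omon E b t.
Proof. by apply: opoly_inj; rewrite /= scalerDl. Qed.

Lemma omon_sum (E : ore_datum R n) t (I : Type) (r : seq I) (P : pred I) F :
  omon E (\sum_(i <- r | P i) F i) t = \sum_(i <- r | P i) omon E (F i) t.
Proof. by apply: (big_morph (omon E ^~ t)) => [a b|]; rewrite ?omonD ?omon0. Qed.

Lemma omon10 (E : ore_datum R n) : omon E 1 0 = 1.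
Proof. by apply: opoly_inj; rewrite /= scale1r mpolyX0. Qed.

(** Moving a scalar past t in the graded extension produces alpha_t, so identities for [alpha_term]
    follow from associativity there. *)
Lemma alpha_term_gmonE t a : gmon (alpha_term D t a) t = gmon 1 t * gmon a 0.
Proof. by rewrite graded_omonM mul1r addm0. Qed.

Fact alpha_term_is_additive t : additive (alpha_term D t).
Proof.
move=> a b; rewrite /alpha_term; elim: (enum _) => //= i s ->.
by elim: (t i) => //= k ->; rewrite raddfB.
Qed.
HB.instance Definition _ t :=
  GRing.isAdditive.Build R R (alpha_term D t) (alpha_term_is_additive t).

Lemma alpha_termM t : {morph alpha_term D t : a b / a * b}.
Proof.
move=> a b; rewrite /alpha_term; elim: (enum _) => //= i s ->.
by elim: (t i) => //= k ->; rewrite rmorphM.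
Qed.

Lemma alpha_term0 a : alpha_term D 0%MM a = a.
Proof. by rewrite /alpha_term; elim: (enum _) => //= i s ->; rewrite mnm0E. Qed.

Lemma alpha_termD t w a :
  alpha_term D (t + w)%MM a = alpha_term D t (alpha_term D w a).
Proof.
apply: (@omon_inj (graded D) (t + w)%MM).
by rewrite alpha_term_gmonE -omon1M -mulrA -alpha_term_gmonE graded_omonM mul1r.
Qed.

Lemma alpha_termU i a : alpha_term D U_(i)%MM a = oalpha D i a.
Proof.
apply: (@omon_inj (graded D) U_(i)%MM).
rewrite alpha_term_gmonE; apply: opoly_inj; rewrite oreYM /=.
by rewrite ore_lmulYZ ore_lmulY_X addm0 /= scale0r addr0.
Qed.

Lemma alpha_term_bij t :
  (forall i, bijective (oalpha D i)) -> bijective (alpha_term D t).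
Proof.
move=> bij; elim/multinom_ind: t => [|i t IH].
  by apply: (eq_bij (f := id)) => [|a]; [exists id | rewrite alpha_term0].
apply: (eq_bij (bij_comp (bij i) IH)) => a.
by rewrite alpha_termD alpha_termU.
Qed.

Lemma graded_mcoeffM (p : ore (graded D)) a t w :
  (opoly (p * gmon a t))@_w =
  if (t <= w)%MM then (opoly p)@_(w - t) * alpha_term D (w - t) a else 0.
Proof.
rewrite {1}[p]ore_sum mulr_suml opoly_sum raddf_sum.
transitivity (\sum_(v <- msupp (opoly p)) if (v + t)%MM == w
    then (opoly p)@_v * alpha_term D v a else 0).
  by apply: eq_bigr => v _; rewrite graded_omonM; apply: mcoeff_omon.
case: ifP => le_tw; last first.
  rewrite big1 // => v _; case: eqP => // e.
  by rewrite -e lem_addl in le_tw.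
rewrite [in RHS](mpolyE (opoly p)) raddf_sum mulr_suml; apply: eq_bigr => v _ /=.
rewrite mcoeffZ mcoeffX.
have -> : (v + t == w)%MM = (v == w - t)%MM.
  by apply/eqP/eqP=> [<-|->]; rewrite ?addmK ?submK.
by case: eqP => [->|_]; rewrite ?mulr1 ?mulr0 ?mul0r.
Qed.

End AlphaTerm.

(** * Terms and leading coefficients under left multiplication by a term *)

(* A term t is compared through [e t], which is instantiated by [(t, k)] for
   entries of vectors in R^m and by t T(g_i) for coefficients of g_i. *)
Section LeadingCoefficient.
Variables (R : nzRingType) (n : nat) (D : ore_datum R n).
Variables (T : eqType) (lt : rel T) (act : 'X_{1..n} -> T -> T).
Variable e : 'X_{1..n} -> T.
Hypotheses (lt_irr : irreflexive lt) (lt_trans : transitive lt).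
Hypothesis act0 : forall x, act 0%MM x = x.
Hypothesis actD : forall v w x, act (v + w)%MM x = act v (act w x).
Hypothesis act_e : forall w t, e (w + t)%MM = act w (e t).
Hypothesis lt_act : forall i x, lt x (act U_(i)%MM x).
Hypothesis act_homo : forall w x y, lt x y -> lt (act w x) (act w y).

Local Notation le x y := ((x == y) || lt x y).

Let le_trans x y z : le x y -> le y z -> le x z.
Proof.
case/predU1P=> [->//|xy] /predU1P[<-|/(lt_trans xy)->]; by rewrite ?xy orbT.
Qed.

Let act_le w x y : le x y -> le (act w x) (act w y).
Proof. by case/predU1P=> [->|/act_homo->]; rewrite ?eqxx ?orbT. Qed.

(** A factor Y_i either shifts a term, through alpha_i, or leaves it in place, through delta_i; by
    [lt_act] the shifted term is the larger. *)
Lemma ore_lmulX_supp w p t : (ore_lmulX D w p)@_t != 0 ->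
  exists2 s, p@_s != 0 & le (e t) (act w (e s)).
Proof.
elim/multinom_ind: w t => [|i w IH] t.
  by rewrite ore_lmulX0 => pt; exists t; rewrite ?act0 ?eqxx.
rewrite ore_lmulXD ore_lmulXU; set q := ore_lmulX D w p in IH * => qt.
have [s qs le_ts] : exists2 s, q@_s != 0 & le (e t) (act U_(i)%MM (e s)).
  have [q0|] := eqVneq (q@_t) 0; last by exists t; rewrite ?lt_act ?orbT.
  move: qt; rewrite mcoeffD mcoeffMXE !mcoeff_map_mpoly /= q0 raddf0 addr0.
  case: ifP => [le_Ut|_]; last by rewrite eqxx.
  exists (t - U_(i))%MM; last by rewrite -act_e addmC submK ?eqxx.
  by apply: contraNneq qt => ->; rewrite raddf0.
have [r pr le_sr] := IH s qs; exists r => //; rewrite actD.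
exact: le_trans le_ts (act_le _ le_sr).
Qed.

Lemma ore_lmulX_coef w t p : (forall s, p@_s != 0 -> le (e s) (e t)) ->
  (ore_lmulX D w p)@_(w + t) = alpha_term D w p@_t.
Proof.
move=> pt; elim/multinom_ind: w => [|i w IH].
  by rewrite alpha_term0 ore_lmulX0 add0m.
rewrite alpha_termD alpha_termU -IH // ore_lmulXD ore_lmulXU -addmA.
rewrite mcoeffD mcoeffMXE !mcoeff_map_mpoly /= lem_addr addmC addmK.
(* The delta_i part would need the term Y_i w t to occur already in the product of w and p, whose
   terms are at most w t. *)
suff /eqP-> : (ore_lmulX D w p)@_(w + t + U_(i)) == 0 by rewrite raddf0 addr0.
apply: contraT => /ore_lmulX_supp[s /pt/(act_le w) le1 le2].
have := le_trans le2 le1; rewrite addmC !act_e; set x := act w (e t) => le.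
have := lt_act i x; case/predU1P: le => [->|/lt_trans h /h]; by rewrite lt_irr.
Qed.

End LeadingCoefficient.

(** * Syzygies of monomials and their homogeneous components *)

Section GradedSyzygies.
Variables (R : nzRingType) (n : nat) (D : ore_datum R n) (m u : nat).
Variables (c : 'I_u -> R) (tau : 'I_u -> 'X_{1..n}) (l : 'I_u -> 'I_m).
Implicit Types (w x : mterm n m) (d : 'rV[R]_u) (h : 'rV[ore (graded D)]_u).
Implicit Types (t v : 'X_{1..n}).

Local Notation T i := (tau i, l i).
Local Notation lift := (lift_syz D tau l).
Local Notation gmon := (omon (graded D)).

Lemma tmul0 x : tmul 0%MM x = x.
Proof. by case: x => t k; rewrite /tmul add0m. Qed.

Lemma tmulD t v x : tmul (t + v)%MM x = tmul t (tmul v x).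
Proof. by rewrite /tmul /= addmA. Qed.

Lemma tmul_inj v : injective (@tmul n m v).
Proof.
move=> [t i] [s j] e; have := congr1 snd e; have := congr1 fst e => /= /eqP.
by rewrite !(addmC v) eqm_add2r => /eqP-> ->.
Qed.

Lemma tdvd_tmul t x : tdvd x (tmul t x).
Proof. by rewrite /tdvd eqxx lem_addl. Qed.

Lemma tdvd_tmulr t x w : tdvd x w -> tdvd x (tmul t w).
Proof.
case/andP=> e le; rewrite /tdvd e /=; apply: lepm_trans le _; exact: lem_addl.
Qed.

Lemma tdvdK x w : tdvd x w -> tmul (w.1 - x.1)%MM x = w.
Proof. by case/andP=> /eqP e le; rewrite /tmul submK // e -surjective_pairing. Qed.

Lemma rcoef_vmon a x k t : rcoef k t (vmon D a x) = if x == (t, k) then a else 0.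
Proof.
case: x => s j; rewrite /rcoef mxE [delta_mx _ _ _ _]mxE eqxx xpair_eqE (eq_sym k) andTb.
case: (j == k); last by rewrite mulr0 andbF mcoeff0.
by rewrite mulr1 andbT; apply: mcoeff_omon.
Qed.

Lemma vmon0 x : vmon D 0 x = 0.
Proof. by rewrite /vmon omon0 scale0r. Qed.

Lemma vmon_sum x (I : Type) (r : seq I) (P : pred I) (F : I -> R) :
  vmon D (\sum_(i <- r | P i) F i) x = \sum_(i <- r | P i) vmon D (F i) x.
Proof. by rewrite /vmon omon_sum scaler_suml. Qed.

Lemma omon_vmon a t b x :
  gmon a t *: vmon D b x = vmon D (a * alpha_term D t b) (tmul t x).
Proof. by rewrite /vmon scalerA graded_omonM. Qed.

Lemma rcoef_lift w d i t :
  rcoef i t (lift w d) = if w == tmul t (T i) then d 0 i else 0.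
Proof.
rewrite /rcoef mxE; case: ifPn => [dv|ndv]; last first.
  by rewrite mcoeff0; case: eqP => // e; rewrite e tdvd_tmul in ndv.
rewrite mcoeff_omon -{2}(tdvdK dv) /tmul xpair_eqE eqxx andbT /=.
by rewrite eqm_add2r.
Qed.

Fact lift_syz_is_additive w : additive (lift w).
Proof.
move=> d d'; apply: rcoefP => i t.
by rewrite raddfB /= !rcoef_lift !mxE; case: ifP; rewrite ?subrr.
Qed.
HB.instance Definition _ w :=
  GRing.isAdditive.Build 'rV[R]_u 'rV[ore (graded D)]_u (lift w)
    (lift_syz_is_additive w).

(** Multiplication by v raises the degree from w to v w. The test on w remains in the row because
    T(g_i) may divide v w without dividing w. *)
Lemma omon_lift a v w d : gmon a v *: lift w d =
  lift (tmul v w)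
    (\row_i if tdvd (T i) w then a * alpha_term D v (d 0 i) else 0).
Proof.
apply/rowP=> i; rewrite !mxE; case: ifPn => [dv|_].
  by rewrite tdvd_tmulr // graded_omonM /= addmBA //; case/andP: dv.
by rewrite mulr0 omon0; case: ifP.
Qed.

Lemma lift_scale a w d : lift w (a *: d) = gmon a 0 *: lift w d.
Proof.
apply/rowP=> i; rewrite !mxE; case: ifPn => _; last by rewrite mulr0.
by rewrite graded_omonM add0m alpha_term0.
Qed.

(** When T(g_i) does not divide w the subtraction is truncated and the entry carries no meaning;
    [lift_syz] and [vcoef] both vanish there. *)
Definition slice w h : 'rV[R]_u := \row_i rcoef i (w.1 - tau i)%MM h.

(** The component of degree w for the grading that gives t e_i the degree t T(g_i). *)
Definition hcomp w h := lift w (slice w h).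

Lemma rcoef_hcomp w h i t :
  rcoef i t (hcomp w h) = if w == tmul t (T i) then rcoef i t h else 0.
Proof. by rewrite rcoef_lift mxE; case: eqP => // ->; rewrite addmK. Qed.

Fact hcomp_is_additive w : additive (hcomp w).
Proof.
move=> h h'; apply: rcoefP => i t; rewrite raddfB /= !rcoef_hcomp raddfB.
by case: ifP; rewrite ?subrr.
Qed.
HB.instance Definition _ w :=
  GRing.isAdditive.Build 'rV[ore (graded D)]_u 'rV[ore (graded D)]_u (hcomp w)
    (hcomp_is_additive w).

Lemma hcomp_lift w x d : hcomp w (lift x d) = if x == w then lift x d else 0.
Proof.
apply: rcoefP => i t; rewrite rcoef_hcomp rcoef_lift [x == w]eq_sym.
have [<-|ne] := eqVneq w x; first by rewrite rcoef_lift; case: (w == _).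
rewrite raddf0; by case: (w =P _) => // <-; rewrite eq_sym (negPf ne).
Qed.

Lemma sum_hcomp h : exists s : seq (mterm n m), h = \sum_(w <- s) hcomp w h.
Proof.
(* Several terms of h may share a degree; [undup] keeps its component from being added twice. *)
pose s := undup [seq tmul t (T i) | i <- enum 'I_u, t <- msupp (opoly (h 0 i))].
exists s; apply: rcoefP => i t; rewrite raddf_sum /=.
rewrite (eq_bigr _ (fun w _ => rcoef_hcomp w h i t)) -big_mkcond /=.
have [ts|nts] := boolP (tmul t (T i) \in s).
  rewrite (big_rem _ ts) /= eqxx big_seq_cond big1 ?addr0 // => w.
  by rewrite mem_rem_uniq ?undup_uniq // inE => /andP[/andP[/negPf->]].
rewrite big_seq_cond big1 => [|w /andP[ws /eqP e]]; last by rewrite -e ws in nts.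
apply/eqP; apply: contraR nts => nz; rewrite mem_undup; apply/allpairsPdep.
by exists i, t; rewrite mem_enum mcoeff_msupp.
Qed.

Definition syzygy w d := \sum_i d 0 i * vcoef D c tau l w i = 0.

(** The map s_L, with the maximal monomials given by [c], [tau] and [l], so that this part does not
    involve the g_i. *)
Definition symb h : 'rV[ore (graded D)]_m := \sum_i h 0 i *: vmon D (c i) (T i).

Lemma symbD h h' : symb (h + h') = symb h + symb h'.
Proof. by rewrite -big_split; apply: eq_bigr => i _; rewrite mxE scalerDl. Qed.

Lemma symbZ (a : ore (graded D)) h : symb (a *: h) = a *: symb h.
Proof. by rewrite scaler_sumr; apply: eq_bigr => i _; rewrite mxE scalerA. Qed.

(** Each coefficient of s_L(h) involves a single component of h, so h lies in the kernel exactly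
    when all its slices are syzygies over R. *)
Lemma rcoef_symb k t h :
  rcoef k t (symb h) = \sum_i slice (t, k) h 0 i * vcoef D c tau l (t, k) i.
Proof.
rewrite raddf_sum; apply: eq_bigr => i _ /=; rewrite mxE /rcoef mxE.
rewrite [vmon _ _ _ _ _]mxE [delta_mx _ _ _ _]mxE eqxx andTb /vcoef /tdvd (eq_sym k).
case: (_ == _); last by rewrite !mulr0 mcoeff0.
rewrite mulr1 graded_mcoeffM andTb; case: ifP => //; by rewrite mulr0.
Qed.

Lemma symb_lift w d :
  symb (lift w d) = vmon D (\sum_i d 0 i * vcoef D c tau l w i) w.
Proof.
rewrite vmon_sum; apply: eq_bigr => i _; rewrite mxE /vcoef.
case: ifPn => [dv|_]; last by rewrite scale0r mulr0 vmon0.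
by rewrite omon_vmon (tdvdK dv).
Qed.

(** In the second case x is the lcm of the T(g_i) dividing w: it divides w, and each of them divides
    it. *)
Lemma lcm_termsP w : (forall i, ~~ tdvd (T i) w) \/
  exists v x, [/\ lcm_terms tau l x, w = tmul v x &
    forall i, tdvd (T i) x = tdvd (T i) w].
Proof.
pose H := [set i | tdvd (T i) w]; have [H0|Hn0] := eqVneq H set0.
  by left=> i; have := in_set0 i; rewrite -H0 inE => ->.
right; set t := \big[@mlcm n/0%MM]_(i in H) tau i.
have le_tw : (t <= w.1)%MM.
  by rewrite lem_big_mlcm; apply/forall_inP=> i; rewrite inE => /andP[].
exists (w.1 - t)%MM, (t, w.2); split=> [||i].
- by exists H; split=> // i; rewrite inE => /andP[/eqP].
- by rewrite /tmul submK // -surjective_pairing.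
apply/idP/idP => [/(@tdvd_tmulr (w.1 - t)%MM)|dv].
  by rewrite /tmul /= submK // -surjective_pairing.
have := lepm_refl t; rewrite {1}/t lem_big_mlcm => /forall_inP/(_ i).
by rewrite inE dv /tdvd => -> //; case/andP: dv => ->.
Qed.

(** * Generation of homogeneous syzygies by [S'] *)

Variables (C : mterm n m -> seq 'rV[R]_u) (S' : 'rV[ore (graded D)]_u -> Prop).

(** Every summand has degree w. A plain [lspan] loses this control, which is needed later to bound
    the terms of values of syzygies. *)
Inductive hspan (w : mterm n m) : 'rV[ore (graded D)]_u -> Prop :=
| hspan0 : hspan w 0
| hspanD h h' : hspan w h -> hspan w h' -> hspan w (h + h')
| hspan_gen a v x d : tmul v x = w -> lcm_terms tau l x -> d \in C x ->
    S' (lift x d) -> hspan w (gmon a v *: lift x d).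

Lemma hspan_omonZ a v w h : hspan w h -> hspan (tmul v w) (gmon a v *: h).
Proof.
elim=> {h} [|h h' _ IH _ IH'|b t x d <- lx dC Sd].
- rewrite scaler0; exact: hspan0.
- rewrite scalerDr; exact: hspanD.
- by rewrite scalerA graded_omonM; apply: hspan_gen; rewrite ?tmulD.
Qed.

Lemma hspan_lspan w h : hspan w h -> lspan S' h.
Proof.
elim=> {h} [|h h' _ IH _ IH'|a v x d _ _ _ Sd]; first exact: lspan0.
  exact: lspanD.
exact/lspanZ/lspan_mem.
Qed.

Hypothesis alpha_aut : forall i : 'I_n, bijective (oalpha D i).
Hypothesis C_gens : forall x, lcm_terms tau l x -> syz_gens D c tau l x (C x).
Hypothesis S'_reduced : reduced_syz_set (syz_set tau l C) S'.

(** A discarded generator is a sum of multiples of elements of [S'] of possibly mixed degrees;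
    taking components of degree x removes the summands of other degrees. *)
Lemma hspan_syz_set x d : lcm_terms tau l x -> d \in C x -> hspan x (lift x d).
Proof.
move=> lx dC; have [S'P redS] := S'_reduced.
have [Sd|nSd] := classic (S' (lift x d)).
  rewrite -[lift x d]scale1r -(omon10 (graded D)); apply: hspan_gen => //.
  exact: tmul0.
have [r [rS e]] : exists r : seq (R * 'X_{1..n} * 'rV[ore (graded D)]_u),
    (forall p, p \in r -> S' p.2) /\
    lift x d = \sum_(p <- r) gmon p.1.1 p.1.2 *: p.2.
  by apply: redS => //; exists x; split=> //; exists d.
have -> : lift x d = hcomp x (lift x d) by rewrite hcomp_lift eqxx.
rewrite e raddf_sum big_seq; apply: big_ind => [||p /rS Sp].
- exact: hspan0.
- exact: hspanD.
have [y [ly [b bC ep]]] := S'P _ Sp.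
rewrite /= ep omon_lift hcomp_lift; case: eqP => [<-|_]; last exact: hspan0.
by rewrite -omon_lift; apply: hspan_gen; rewrite -?ep.
Qed.

(* Since alpha_v is onto, a syzygy at [w = v x] is v times a syzygy at the
   least common multiple x of the T(g_i) dividing w. *)
Lemma syzygy_hspan w d : syzygy w d -> hspan w (lift w d).
Proof.
move=> dw; have [ndv|[v [x [lx ew dvE]]]] := lcm_termsP w.
  suff -> : lift w d = 0 by apply: hspan0.
  by apply/rowP=> i; rewrite !mxE (negPf (ndv i)).
have [beta alphaK betaK] := alpha_term_bij v alpha_aut.
pose d' : 'rV[R]_u := \row_i beta (d 0 i).
have ->: lift w d = gmon 1 v *: lift x d'.
  rewrite omon_lift -ew; apply/rowP=> i; rewrite !mxE dvE; case: ifP => // _.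
  by rewrite betaK mul1r.
rewrite ew; apply: hspan_omonZ.
have : lspan (fun b => b \in C x) d'.
  (* As alpha_v is injective, it suffices to check the image of the equation at x, which is the
     syzygy at w. *)
  apply/(C_gens lx); apply: (bij_inj (alpha_term_bij v alpha_aut)).
  rewrite raddf0 -[RHS]dw raddf_sum; apply: eq_bigr => i _ /=.
  rewrite alpha_termM mxE betaK /vcoef dvE; case: ifPn => [dv|_].
    rewrite -alpha_termD ew /= addmBA //.
    by move: dv; rewrite -dvE => /andP[].
  by rewrite raddf0.
elim/lspan_ind => [|b b' hb hb'|a b bC]; first by rewrite raddf0; apply: hspan0.
  by rewrite raddfD; apply: hspanD.
by rewrite lift_scale -{1}[x]tmul0; apply/hspan_omonZ/hspan_syz_set.
Qed.

Lemma symb_eq0P h : symb h = 0 <-> lspan S' h.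
Proof.
split=> [h0|].
  have [s ->] := sum_hcomp h; apply: big_ind => [||w _].
  - exact: lspan0.
  - exact: lspanD.
  apply: (@hspan_lspan w); apply: syzygy_hspan; case: w => t k.
  by rewrite /syzygy -rcoef_symb h0 raddf0.
elim/lspan_ind => [|x y x0 y0|a s /(proj1 S'_reduced)[x [lx [d dC ->]]]].
- by have := symbZ 0 0; rewrite !scale0r.
- by rewrite symbD x0 y0 addr0.
have dx : syzygy x d by apply/(C_gens lx); apply: lspan_mem.
by rewrite symbZ symb_lift dx vmon0 scaler0.
Qed.

End GradedSyzygies.

(** * Maximal terms in the free module over the Ore extension *)

Section Representations.
Variables (R : nzRingType) (n : nat) (D : ore_datum R n) (m : nat).
Variables (tlt : rel 'X_{1..n}) (mlt : rel (mterm n m)).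
Hypothesis tlt_order : term_order tlt.
Hypothesis mlt_order : compatible_term_order tlt mlt.
Implicit Types (w x y : mterm n m) (f : 'rV[ore D]_m) (t v : 'X_{1..n}).

Local Notation mle x y := ((x == y) || mlt x y).
Local Notation gmon := (omon (graded D)).

Let mlt_wo : strict_well_order mlt.
Proof. by case: mlt_order. Qed.

Let mlt_irr : irreflexive mlt. Proof. by case: mlt_wo. Qed.
Let mlt_trans : transitive mlt. Proof. by case: mlt_wo. Qed.
Let mlt_wf : well_founded (fun x y => mlt x y). Proof. by case: mlt_wo. Qed.

Let tmul_lt v x y : mlt x y -> mlt (tmul v x) (tmul v y).
Proof. by case: mlt_order => _ _; apply. Qed.

Let lt_tmulU i x : mlt x (tmul U_(i)%MM x).
Proof.
rewrite -{1}[x]tmul0; case: mlt_order => _ + _; apply.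
by apply: (term_order_gt0 tlt_order); rewrite -mdeg_eq0 mdeg1.
Qed.

Let mle_trans x y w : mle x y -> mle y w -> mle x w.
Proof.
case/predU1P=> [->//|xy] /predU1P[<-|/(mlt_trans xy)->]; by rewrite ?xy orbT.
Qed.

Let mle_lt_trans x y w : mle x y -> mlt y w -> mlt x w.
Proof. by case/predU1P=> [->//|/mlt_trans]; apply. Qed.

Let tmul_le v x y : mle x y -> mle (tmul v x) (tmul v y).
Proof. by case/predU1P=> [->|/tmul_lt->]; rewrite ?eqxx ?orbT. Qed.

Lemma mem_vsupp f t k : ((t, k) \in vsupp f) = (rcoef k t f != 0).
Proof.
rewrite -mcoeff_msupp; apply/allpairsPdep/idP => [[k' [t' [_ ts [-> ->]]]] //|ts].
by exists k, t; rewrite mem_enum.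
Qed.

Lemma maxT_Some f x : maxT mlt f = Some x -> rcoef x.2 x.1 f != 0 /\
  forall k t, rcoef k t f != 0 -> mle (t, k) x.
Proof.
case: x => s j /(omaximum_Some mlt_wo)[]; rewrite mem_vsupp => fs fmax.
by split=> // k t; rewrite -mem_vsupp; apply: fmax.
Qed.

Lemma maxT_None f : maxT mlt f = None -> f = 0.
Proof.
move=> /omaximum_None f0; apply: rcoefP => k t; rewrite raddf0.
by apply/eqP; rewrite -[_ == _]negbK -mem_vsupp f0.
Qed.

Lemma maxT_coef0 f x y : maxT mlt f = Some y -> mlt y x -> rcoef x.2 x.1 f = 0.
Proof.
move=> /maxT_Some[_ fmax] yx; apply/eqP; apply: contraT => /fmax.
by rewrite -surjective_pairing => /mle_lt_trans/(_ yx); rewrite mlt_irr.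
Qed.

Lemma omonZ_supp a v f k t : rcoef k t (omon D a v *: f) != 0 ->
  exists2 s, rcoef k s f != 0 & mle (t, k) (tmul v (s, k)).
Proof.
rewrite rcoef_omonZ => nz.
apply: (ore_lmulX_supp (D := D) (w := v) (e := fun s => (s, k)) mlt_trans (@tmul0 n m)
  (@tmulD n m) (fun _ _ => erefl) lt_tmulU tmul_lt) => //.
by apply: contraNneq nz => ->; rewrite mulr0.
Qed.

Lemma omonZ_coef a v f x : (forall k t, rcoef k t f != 0 -> mle (t, k) x) ->
  rcoef x.2 (v + x.1)%MM (omon D a v *: f) = a * alpha_term D v (rcoef x.2 x.1 f).
Proof.
case: x => s j fx; rewrite rcoef_omonZ; congr (_ * _).
apply: (ore_lmulX_coef D (e := fun t => (t, j)) mlt_irr mlt_trans (@tmul0 n m)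
  (@tmulD n m) (fun _ _ => erefl) lt_tmulU tmul_lt v (t := s)
  (p := opoly (f 0 j))); exact: fx.
Qed.

(** * Evaluation at F and representations with bounded degrees *)

Variables (u : nat) (g : 'I_u -> 'rV[ore D]_m).
Hypothesis g_neq0 : forall i, g i != 0.
Variables (c : 'I_u -> R) (tau : 'I_u -> 'X_{1..n}) (l : 'I_u -> 'I_m).
Hypothesis g_maxM : forall i, maxM mlt (g i) = vmon D (c i) (tau i, l i).
Implicit Types (h : 'rV[ore (graded D)]_u) (d : 'rV[R]_u).
Implicit Type A : mterm n m -> Prop.

Local Notation T i := (tau i, l i).
Local Notation lift := (lift_syz D tau l).
Local Notation gspan := (lspan (fun f => exists i, f = g i)).

(** As g_i is nonzero, so is its leading coefficient; hence the equality of monomials determines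
    both the term and the coefficient. *)
Lemma maxT_g i : maxT mlt (g i) = Some (T i) /\ rcoef (l i) (tau i) (g i) = c i.
Proof.
have := g_maxM i; rewrite /maxM; case E: (maxT mlt (g i)) => [x|]; last first.
  by move: (g_neq0 i); rewrite (maxT_None E) eqxx.
have [nz _] := maxT_Some E => /(congr1 (rcoef x.2 x.1)).
rewrite !rcoef_vmon -surjective_pairing eqxx -/(rcoef x.2 x.1 (g i)).
by case: (T i =P x) => [<- //|_ e]; rewrite e eqxx in nz.
Qed.

Lemma g_bounded i k t : rcoef k t (g i) != 0 -> mle (t, k) (T i).
Proof. by have [/maxT_Some[_ gmax] _] := maxT_g i; apply: gmax. Qed.

(** Rows over the graded extension serve as coefficients, so that syzygies can be evaluated as they
    stand. *)
Definition evalg h : 'rV[ore D]_m := \sum_i ungrade (h 0 i) *: g i.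

Fact evalg_is_additive : additive evalg.
Proof.
move=> h h'; rewrite /evalg -sumrB; apply: eq_bigr => i _.
by rewrite !mxE -scalerBl.
Qed.
HB.instance Definition _ :=
  GRing.isAdditive.Build 'rV[ore (graded D)]_u 'rV[ore D]_m evalg
    evalg_is_additive.

Lemma evalg_supp h k t : rcoef k t (evalg h) != 0 ->
  exists i s, rcoef i s h != 0 /\ mle (t, k) (tmul s (T i)).
Proof.
move: k t; apply: (big_ind (supp_in (fun t k => exists i s, rcoef i s h != 0 /\
  mle (t, k) (tmul s (T i))))) => [||i _]; [exact: supp_in0 | exact: supp_inD |].
rewrite [ungrade _]ore_sum scaler_suml big_seq.
apply: big_ind => [||s hs k t]; [exact: supp_in0 | exact: supp_inD |].
move=> /omonZ_supp[r /g_bounded/(tmul_le s) le1 le2].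
by exists i, s; rewrite -mcoeff_msupp (mle_trans le2 le1).
Qed.

(** The lower terms of the ungraded products do not reach w, so the coefficient there is the one
    found in s_L. *)
Lemma evalg_lift_coef w d : rcoef w.2 w.1 (evalg (lift w d)) =
  \sum_i d 0 i * vcoef D c tau l w i.
Proof.
rewrite raddf_sum; apply: eq_bigr => i _; rewrite /= mxE /vcoef.
case: ifPn => [dv|_].
  have: tmul (w.1 - tau i)%MM (T i) = w := tdvdK dv.
  move: (w.1 - tau i)%MM => v <-; rewrite -(proj2 (maxT_g i)).
  exact: (omonZ_coef (d 0 i) v (@g_bounded i)).
have -> : ungrade 0 = 0 :> ore D by [].
by rewrite scale0r raddf0 mulr0.
Qed.

(* The ungraded product, encoded in the graded module so that its support can
   be compared with that of the graded product. *)
Definition ore_lact a v h : 'rV[ore (graded D)]_u :=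
  \row_i Ore (graded D) (opoly (omon D a v * ungrade (h 0 i))).

Lemma evalg_lact a v h : evalg (ore_lact a v h) = omon D a v *: evalg h.
Proof.
rewrite scaler_sumr; apply: eq_bigr => i _; rewrite mxE scalerA.
by congr (_ *: _); apply: opoly_inj.
Qed.

Lemma rcoef_lact a v h i t :
  rcoef i t (ore_lact a v h) = a * (ore_lmulX D v (opoly (h 0 i)))@_t.
Proof. by rewrite /rcoef mxE /= ore_mulZl ore_mulX mcoeffZ. Qed.

(** Stated for any datum, since [rep_graded_diff] compares the products of [D] and [graded D]. *)
Lemma lmulX_supp (E : ore_datum R n) v p i t : (ore_lmulX E v p)@_t != 0 ->
  exists2 s, p@_s != 0 & mle (tmul t (T i)) (tmul v (tmul s (T i))).
Proof.
exact: (ore_lmulX_supp (D := E) (w := v) (e := fun s => tmul s (T i)) mlt_trans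
  (@tmul0 n m) (@tmulD n m) (fun v t => tmulD v t _) lt_tmulU tmul_lt).
Qed.

Lemma lmulX_coef (E : ore_datum R n) v p i t :
  (forall s, p@_s != 0 -> mle (tmul s (T i)) (tmul t (T i))) ->
  (ore_lmulX E v p)@_(v + t) = alpha_term E v p@_t.
Proof.
exact: (ore_lmulX_coef E (e := fun s => tmul s (T i)) mlt_irr mlt_trans
  (@tmul0 n m) (@tmulD n m) (fun v t => tmulD v t _) lt_tmulU tmul_lt).
Qed.

(** [A] constrains the degree t T(g_i) of each term of a coefficient; it serves for strict bounds,
    weak bounds and no bound at all. *)
Definition rep A f :=
  exists2 h, supp_in (fun t i => A (tmul t (T i))) h & f = evalg h.

Lemma rep0 A : rep A 0.
Proof. by exists 0; rewrite ?raddf0 //; apply: supp_in0. Qed.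

Lemma repD A f f' : rep A f -> rep A f' -> rep A (f + f').
Proof.
by move=> [h hA ->] [h' hA' ->]; exists (h + h'); [apply: supp_inD | rewrite raddfD].
Qed.

Lemma rep_sub A A' f : (forall x, A x -> A' x) -> rep A f -> rep A' f.
Proof. by move=> AA [h hA ->]; exists h => // i t /hA/AA. Qed.

Lemma rep_omonZ a v x f : rep (fun y => mlt y x) f ->
  rep (fun y => mlt y (tmul v x)) (omon D a v *: f).
Proof.
move=> [h hx ->]; rewrite -evalg_lact; exists (ore_lact a v h) => // i t.
rewrite rcoef_lact => nz; have /(lmulX_supp i)[s /hx hs le_ts] :
    (ore_lmulX D v (opoly (h 0 i)))@_t != 0.
  by apply: contraNneq nz => ->; rewrite mulr0.
exact: mle_lt_trans le_ts (tmul_lt v hs).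
Qed.

(* The graded and ungraded products have the same coefficient alpha_v(b) at the
   top, so only strictly smaller terms survive in the difference. *)
Lemma rep_graded_diff a v x h :
    supp_in (fun t i => mle (tmul t (T i)) x) h ->
  rep (fun y => mlt y (tmul v x)) (evalg (gmon a v *: h) - omon D a v *: evalg h).
Proof.
move=> hx; rewrite -evalg_lact -raddfB; exists (gmon a v *: h - ore_lact a v h) => //.
move=> i t; rewrite raddfB /= rcoef_lact rcoef_omonZ -mulrBr => nz.
have [s hs le_ts] : exists2 s, (opoly (h 0 i))@_s != 0 &
    mle (tmul t (T i)) (tmul v (tmul s (T i))).
  have [e|/(lmulX_supp i)//] := eqVneq (ore_lmulX D v (opoly (h 0 i)))@_t 0.
  apply: (@lmulX_supp (graded D)).
  by apply: contraNneq nz => e'; rewrite e e' subrr mulr0.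
have /(tmul_le v) le_sx := hx i s hs.
have := mle_trans le_ts le_sx; case/predU1P=> // etx; case/eqP: nz.
(* Once t T(g_i) reaches v x, both inequalities are equalities, so t = v s and s T(g_i) = x. *)
have ets : t = (v + s)%MM.
  apply/eqP; rewrite -(eqm_add2r (tau i)) -addmA.
  have : tmul t (T i) = tmul v (tmul s (T i)); last first.
    by move=> /(congr1 fst) e; apply/eqP.
  case/predU1P: le_ts => // /mlt_trans lt_ts.
  by case/predU1P: le_sx => [e|/lt_ts]; rewrite ?etx ?mlt_irr // -e in lt_ts *.
have exs : tmul s (T i) = x.
  by apply: (@tmul_inj _ _ v); rewrite -etx ets tmulD.
have hs' r : (opoly (h 0 i))@_r != 0 -> mle (tmul r (T i)) (tmul s (T i)).
  by rewrite exs; apply: hx.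
rewrite ets (lmulX_coef (graded D) _ hs') (lmulX_coef D _ hs').
by rewrite subrr mulr0.
Qed.

(** A Gröbner representation bounds only the maximal term of l_i, [rep] every term; compatibility of
    the two orders passes the bound on to the smaller terms. *)
Lemma groebner_repP f : has_left_groebner_rep tlt mlt g f <->
  rep (fun x => ole mlt (Some x) (maxT mlt f)) f.
Proof.
have [tlt_wo _] := tlt_order; split=> [[q [ef qf]]|[h hf ef]].
  exists (\row_i Ore (graded D) (opoly (q i))); last first.
    by rewrite ef; apply: eq_bigr => i _; rewrite mxE; congr (_ *: _); apply: opoly_inj.
  move=> i t; rewrite /rcoef mxE /= -mcoeff_msupp => tq.
  have /qf : q i != 0 by apply: contraTneq tq => ->; rewrite msupp0.
  rewrite (proj1 (maxT_g i)) /omaxT; case E: (omaximum _ _) => [s|]; last first.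
    by rewrite (omaximum_None E) in tq.
  have [_ /(_ t tq) le_ts] := omaximum_Some tlt_wo E.
  rewrite /=; case: (maxT mlt f) => // y; apply: mle_trans.
  case/predU1P: le_ts => [->|ts]; rewrite ?eqxx //; apply/orP; right.
  by case: mlt_order => _ + _; apply.
exists (fun i => ungrade (h 0 i)); split=> // i _; rewrite (proj1 (maxT_g i)) /omaxT.
case E: (omaximum _ _) => [s|//]; apply: hf.
by rewrite /rcoef -mcoeff_msupp; case: (omaximum_Some tlt_wo E).
Qed.

Lemma sL_symb h : sL mlt g h = symb c tau l h.
Proof. by apply: eq_bigr => i _; rewrite g_maxM. Qed.

Lemma lift_homogeneous w d : homogeneous mlt g (lift w d).
Proof.
(* Where T(g_i) does not divide w the truncated exponent has the wrong degree, so the coefficient is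
   set to 0. *)
exists (fun i => if tdvd (T i) w then d 0 i else 0), (fun i => (w.1 - tau i)%MM).
split=> [|i j]; first by apply/rowP=> i; rewrite !mxE; case: ifP; rewrite ?omon0.
rewrite !(proj1 (maxT_g _)); case: ifPn => [dvi _|_]; last by rewrite eqxx.
case: ifPn => [dvj _|_]; last by rewrite eqxx.
by congr Some; rewrite [LHS](tdvdK dvi) [RHS](tdvdK dvj).
Qed.

(** * Representations of elements of the generated module *)

Lemma rep_scale_g A (q : ore D) i :
  (forall t, (opoly q)@_t != 0 -> A (tmul t (T i))) -> rep A (q *: g i).
Proof.
move=> qA; exists (\row_j if j == i then Ore (graded D) (opoly q) else 0).
  move=> j t; rewrite /rcoef mxE; case: (j =P i) => [->|_]; last by rewrite mcoeff0 eqxx.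
  exact: qA.
rewrite /evalg (bigD1 i) //= mxE eqxx big1 ?addr0 => [|j /negPf nji].
  by congr (_ *: _); apply: opoly_inj.
by rewrite mxE nji (_ : ungrade 0 = 0 :> ore D) ?scale0r //; apply: opoly_inj.
Qed.

Lemma lspan_rep f : gspan f -> rep (fun=> True) f.
Proof.
elim/lspan_ind => [|x y|q _ [i ->]]; first exact: rep0; first exact: repD.
exact: rep_scale_g.
Qed.

Lemma evalg_lspan h : gspan (evalg h).
Proof.
apply: big_ind => [||i _]; [exact: lspan0 | exact: lspanD |].
by apply/lspanZ/lspan_mem; exists i.
Qed.

(** w is the largest degree occurring in the given representation, which has a term because f is
    nonzero. *)
Lemma rep_max A f : rep A f -> f != 0 ->
  exists2 w, A w & rep (fun x => mle x w) f.
Proof.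
move=> [h hA ->] nz.
pose s := [seq tmul t (T i) | i <- enum 'I_u, t <- msupp (opoly (h 0 i))].
have hs : supp_in (fun t i => tmul t (T i) \in s) h.
  move=> i t ht; apply/allpairsPdep; exists i, t.
  by rewrite mem_enum mcoeff_msupp.
case E: (omaximum mlt s) => [w|]; last first.
  suff h0 : h = 0 by rewrite h0 raddf0 eqxx in nz.
  apply: rcoefP => i t; rewrite raddf0; apply/eqP; apply: contraT => /hs.
  by rewrite (omaximum_None E).
have [/allpairsPdep[i [t [_ ht ->]]] smax] := omaximum_Some mlt_wo E.
exists (tmul t (T i)); first by apply: hA; rewrite -mcoeff_msupp.
by exists h => // j s' /hs/smax.
Qed.

(** Well-founded induction on T(f): subtracting a combination f1 with the same maximal monomial
    leaves zero or a smaller maximal term. *)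
Lemma groebner_basis_rep f x : left_groebner_basis mlt g ->
    gspan f -> maxT mlt f = Some x ->
  rep (fun y => mle y x) f.
Proof.
move=> gb; move: x f; apply: (well_founded_ind mlt_wf) => x IH f fg fx.
have [fx0 fmax] := maxT_Some fx.
have nzf : f != 0 by apply: contraNneq fx0 => ->; rewrite raddf0.
have [s [sP es]] := gb f fg nzf.
have {}sP p : p \in s -> tmul p.1.2 (T p.2) = x.
  by move=> /sP[_]; rewrite (proj1 (maxT_g _)) fx => -[].
(* The expression of M(f) through the M(g_i), read with the product of the Ore extension. *)
pose f1 := \sum_(p <- s) omon D p.1.1 p.1.2 *: g p.2.
have f1x : rep (fun y => mle y x) f1.
  rewrite /f1 big_seq; apply: big_ind => [||p /sP px]; [exact: rep0|exact: repD|].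
  apply: rep_scale_g => t; rewrite mcoeff_omon.
  by case: (p.1.2 =P t) => [<-|_]; rewrite ?px ?eqxx.
have f1E : rcoef x.2 x.1 f1 = rcoef x.2 x.1 f.
  transitivity (rcoef x.2 x.1 (maxM mlt f)); last first.
    by rewrite /maxM fx rcoef_vmon -surjective_pairing eqxx.
  rewrite es !raddf_sum !big_seq; apply: eq_bigr => p /sP px /=.
  rewrite g_maxM omon_vmon px rcoef_vmon -surjective_pairing eqxx -{1 2}px.
  rewrite (@omonZ_coef _ _ _ (T p.2)); last exact: g_bounded.
  by rewrite (proj2 (maxT_g p.2)).
rewrite -[f](subrK f1); apply: repD => //.
case E: (maxT mlt (f - f1)) => [y|]; last by rewrite (maxT_None E); apply: rep0.
have [yn0 _] := maxT_Some E.
(* All terms of f and f1 are at most x, and their coefficients at x agree. *)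
have lt_yx : mlt y x.
  have /predU1P[eyx|//] : mle y x.
    move: yn0; rewrite raddfB /=.
    have [->|/fmax] := eqVneq (rcoef y.2 y.1 f) 0; last by rewrite -surjective_pairing.
    have [h hx ->] := f1x; rewrite sub0r oppr_eq0 => /evalg_supp[i [t [/hx le2 le1]]].
    by move: (mle_trans le1 le2); rewrite -surjective_pairing.
  by move: yn0; rewrite eyx raddfB /= f1E subrr eqxx.
have f1g : gspan f1.
  by have [h _ ->] := f1x; apply: evalg_lspan.
apply: (@rep_sub (fun z => mle z y)) => [z le_zy|].
  by rewrite (mle_lt_trans le_zy lt_yx) orbT.
apply: IH => //; apply: lspanD => //.
by rewrite -scaleN1r; apply: lspanZ.
Qed.

(** * The Gröbner basis criterion through values of syzygies *)

Variables (C : mterm n m -> seq 'rV[R]_u) (S' : 'rV[ore (graded D)]_u -> Prop).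
Hypothesis alpha_aut : forall i : 'I_n, bijective (oalpha D i).
Hypothesis C_gens : forall x, lcm_terms tau l x -> syz_gens D c tau l x (C x).
Hypothesis S'_reduced : reduced_syz_set (syz_set tau l C) S'.

Section Sufficiency.
Hypothesis S'_rep :
  forall f, syz_values g S' f -> has_left_groebner_rep tlt mlt g f.

(** All terms of the value are at most x, and its coefficient at x vanishes because d is a syzygy; a
    bound by its maximal term is thus a strict bound by x. *)
Lemma S'_lift_rep x d : lcm_terms tau l x -> d \in C x -> S' (lift x d) ->
  rep (fun y => mlt y x) (evalg (lift x d)).
Proof.
move=> lx dC Sd; set f := evalg _.
have /groebner_repP : has_left_groebner_rep tlt mlt g f.
  by apply: S'_rep; exists (lift x d).
apply: rep_sub => y; case E: (maxT mlt f) => [z|//] /= le_yz.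
apply: mle_lt_trans le_yz _; have [zn0 _] := maxT_Some E.
have /evalg_supp[i [s []]] := zn0; rewrite rcoef_lift.
case: (x =P _) => [<- _|_]; last by rewrite eqxx.
rewrite -surjective_pairing => /predU1P[ezx|//].
case/eqP: zn0; rewrite ezx evalg_lift_coef.
by apply/(C_gens lx); apply: lspan_mem.
Qed.

(** Each graded multiple is the ungraded one plus a difference representable below w. *)
Lemma hspan_rep w h : hspan tau l C S' w h -> rep (fun y => mlt y w) (evalg h).
Proof.
elim=> {h} [|h h' _ IH _ IH'|a v x d <- lx dC Sd].
- by rewrite raddf0; apply: rep0.
- by rewrite raddfD; apply: repD.
rewrite -(subrK (omon D a v *: evalg (lift x d)) (evalg _)); apply: repD.
  apply: rep_graded_diff => i t; rewrite rcoef_lift.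
  by case: (x =P _) => [->|_]; rewrite eqxx.
exact/rep_omonZ/S'_lift_rep.
Qed.

(** Induction on a bound w for the degrees in a representation of f: if T(f) = w, the component of
    degree w exhibits M(f); otherwise it is a syzygy, and the bound can be lowered. *)
Lemma reps_groebner_basis : left_groebner_basis mlt g.
Proof.
move=> f fg nzf; have [w _] := rep_max (lspan_rep fg) nzf.
elim/(well_founded_ind mlt_wf): w => w IH [h hw ef].
have diffw : supp_in (fun t i => mlt (tmul t (T i)) w) (h - hcomp tau l w h).
  move=> i t; rewrite raddfB /= rcoef_hcomp; have [_|ne] := eqVneq w (tmul t (T i)).
    by rewrite subrr eqxx.
  by rewrite subr0 => /hw /predU1P[e|//]; rewrite e eqxx in ne.
(* The part of h of degree below w contributes nothing at w. *)
have fwE : rcoef w.2 w.1 f =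
    \sum_i slice tau w h 0 i * vcoef D c tau l w i.
  rewrite -evalg_lift_coef ef -{1}[h](subrK (hcomp tau l w h)).
  move: (h - _) diffw => h1 h1w; rewrite !raddfD /=.
  rewrite [X in X + _](_ : _ = 0) ?add0r //.
  apply/eqP; apply: contraT => /evalg_supp[i [t [/h1w lt_tw le_wt]]].
  have := mle_lt_trans le_wt lt_tw.
  by rewrite -surjective_pairing mlt_irr.
case E: (maxT mlt f) => [x|]; last by rewrite (maxT_None E) eqxx in nzf.
have [xn0 _] := maxT_Some E.
have /predU1P[exw|lt_xw] : mle x w.
  move: (xn0); rewrite ef => /evalg_supp[i [t [/hw le2 le1]]].
  by move: (mle_trans le1 le2); rewrite -surjective_pairing.
  (* The definition of a Gröbner basis requires nonzero a_i and products of degree exactly T(f),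
     hence the filter. *)
  pose s := [seq (slice tau w h 0 i, (w.1 - tau i)%MM, i) | i <- enum 'I_u
              & tdvd (T i) w && (slice tau w h 0 i != 0)].
  exists s; split=> [p /mapP[i]|].
    rewrite mem_filter => /andP[/andP[dv nz] _] ->; split=> //.
    by rewrite (proj1 (maxT_g _)) exw /= [tmul _ _](tdvdK dv).
  rewrite {1}/maxM E exw -/(rcoef w.2 w.1 f) fwE vmon_sum.
  rewrite big_map big_filter big_enum_cond.
  rewrite (bigID (fun i => tdvd (T i) w && (slice tau w h 0 i != 0))) /=.
  rewrite [X in _ + X]big1 ?addr0 => [|i].
    apply: eq_bigr => i /andP[dv _]; rewrite g_maxM omon_vmon /vcoef dv.
    by congr vmon; rewrite [RHS](tdvdK dv).
  rewrite negb_and negbK /vcoef => /orP[/negPf->|/eqP->]; last by rewrite mul0r vmon0.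
  by rewrite mulr0 vmon0.
(* As T(f) is below w, the coefficient of f at w is zero, so the component of degree w is a
   syzygy. *)
have fw : rep (fun y => mlt y w) f.
  rewrite ef -[h](subrK (hcomp tau l w h)) raddfD.
  apply: repD; first by exists (h - hcomp tau l w h).
  apply/hspan_rep/(syzygy_hspan (c := c)) => //.
  by rewrite /syzygy -fwE (maxT_coef0 E).
by have [w' lt_w'w fw'] := rep_max fw nzf; rewrite -E; apply: (IH w').
Qed.

End Sufficiency.

Lemma syzygies_gebauer_moeller : gebauer_moeller mlt g S'.
Proof.
split=> [h /(proj1 S'_reduced)[x [_ [d _ ->]]]|h]; first exact: lift_homogeneous.
by rewrite sL_symb; apply: (symb_eq0P (c := c)) S'_reduced _.
Qed.

(** For necessity, values of syzygies lie in the module generated by F, all of whose elements a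
    Gröbner basis represents. *)
Lemma groebner_basisP : left_groebner_basis mlt g <->
  forall f, syz_values g S' f -> has_left_groebner_rep tlt mlt g f.
Proof.
split=> [gb f [s _ ef]|]; last exact: reps_groebner_basis.
apply/groebner_repP; case E: (maxT mlt f) => [x|]; last first.
  by rewrite (maxT_None E); apply: rep0.
by apply: groebner_basis_rep => //; rewrite ef; apply: evalg_lspan.
Qed.

End Representations.

Theorem corollary44
  (R : nzRingType)
  (R_domain : forall a b : R, a * b = 0 -> a = 0 \/ b = 0)
  (R_zacharias : left_zacharias R)
  (n : nat) (D : ore_datum R n)
  (alpha_aut : forall i : 'I_n, bijective (oalpha D i))
  (m : nat) (tlt : rel 'X_{1..n}) (mlt : rel (mterm n m))
  (tlt_order : term_order tlt)
  (mlt_order : compatible_term_order tlt mlt)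
  (u : nat) (g : 'I_u -> 'rV[ore D]_m)
  (g_neq0 : forall i, g i != 0)
  (c : 'I_u -> R) (tau : 'I_u -> 'X_{1..n}) (l : 'I_u -> 'I_m)
  (g_maxM : forall i, maxM mlt (g i) = vmon D (c i) (tau i, l i))
  (C : mterm n m -> seq 'rV[R]_u)
  (C_gens : forall t, lcm_terms tau l t -> syz_gens D c tau l t (C t))
  (S' : 'rV[ore (graded D)]_u -> Prop)
  (S'_reduced : reduced_syz_set (syz_set tau l C) S') :
  gebauer_moeller mlt g S' /\
  (left_groebner_basis mlt g <->
   forall h : 'rV[ore D]_m, syz_values g S' h ->
     has_left_groebner_rep tlt mlt g h).
Proof.
split.
  exact: (syzygies_gebauer_moeller mlt_order g_neq0 g_maxM alpha_aut C_gens).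
exact: (groebner_basisP tlt_order mlt_order g_neq0 g_maxM alpha_aut C_gens).
Qed.
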